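(* Let $K$ be a field and $q\in K$. Let $\phi_q:\mathcal F\to\mathbf{QSym}$ be the linear map defined on finite spaces $\overline{\mathcal T}$ by $$\phi_q(\overline{\mathcal T})=\sum_{f\in Lin(\mathcal T)}q^{\alpha(f)}\prod_{i\in E(\mathcal T)}x_{f(i)},$$ where $E(\mathcal T)$ is the set underlying $\mathcal T$. This defines a surjective Hopf algebra morphism from $(\mathcal F,.,\Delta)$ to $\mathbf{QSym}$. Moreover, for all finite spaces $\overline{\mathcal T}$, $$\phi_q(\overline{\mathcal T})=\sum_{f\in Lin_{Std}(\mathcal T)}q^{\alpha(f)}M_{P(f)}.$$
   Context: Finite spaces. A finite space is a homeomorphism class $\overline{\mathcal T}$ of topologies $\mathcal T$ on finite sets; $\mathcal F$ is the $K$-vector space with basis all finite spaces, graded by cardinality; the empty space is the unit $1$. The product $.$ on $\mathcal F$ is the bilinear extension of disjoint union of topological spaces. The coproduct is the linear extension of $$\Delta(\overline{\mathcal T})=\sum_{O\in\mathcal T}\overline{\mathcal T_{\mid E\setminus O}}\otimes\overline{\mathcal T_{\mid O}}$$ for $\mathcal T$ a topology on a finite set $E$, where the sum is over open sets $O$ and $\mathcal T_{\mid Y}$ denotes the induced topology on $Y\subseteq E$. With these, $(\mathcal F,.,\Delta)$ is a graded connected commutative Hopf algebra. Preorder. For a topology $\mathcal T$ on a finite set $E$, $i\leq_{\mathcal T}j$ if every open set of $\mathcal T$ containing $i$ also contains $j$. Write $i\sim_{\mathcal T}j$ if $i\leq_{\mathcal T}j$ and $j\leq_{\mathcal T}i$,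 and $i<_{\mathcal T}j$ if $i\leq_{\mathcal T}j$ and not $i\sim_{\mathcal T}j$. Linear extensions. A linear extension of $\mathcal T$ is a map $f:E\to\mathbb N_{>0}$ such that $i\leq_{\mathcal T}j$ implies $f(i)\leq f(j)$; $Lin(\mathcal T)$ is the set of them. $f$ is standard if $f(E)=[k]=\{1,\dots,k\}$ for some integer $k\geq0$; $Lin_{Std}(\mathcal T)$ is the set of standard linear extensions. If $f(E)=\{i_1<\dots<i_k\}$, put $P(f)=(|f^{-1}(i_1)|,\dots,|f^{-1}(i_k)|)$. Put $\alpha(f)=|\{(i,j)\in E\times E\mid i<_{\mathcal T}j\text{ and }f(i)=f(j)\}|$. Here $q^0=1$, also when $q=0$. Quasi-symmetric functions. $\mathbf{QSym}\subset K[[x_1,x_2,\dots]]$ is the algebra of quasisymmetric formal series of bounded degree: series such that for every strictly increasing $g:\mathbb N_{>0}\to\mathbb N_{>0}$ and all $a_1,\dots,a_n\in\mathbb N$, the coefficients of $x_1^{a_1}\cdots x_n^{a_n}$ and $x_{g(1)}^{a_1}\cdots x_{g(n)}^{a_n}$ are equal. A basis is given by $M_a=\sum_{i_1<\dots<i_n}x_{i_1}^{a_1}\cdots x_{i_n}^{a_n}$, for compositions $a=(a_1,\dots,a_n)$ (finite sequences of positive integers), $M_\emptyset=1$. It is a Hopf algebra for the usual product of series and the coproduct $\Delta(M_{(a_1,\dots,a_n)})=\sum_{i=0}^nM_{(a_1,\dots,a_i)}\otimes M_{(a_{i+1},\dots,a_n)}$. *)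

(* Defs.v *)
From HB Require Import structures.
From mathcomp Require Import all_boot all_algebra finmap.
From mathcomp Require Import generic_quotient ring_quotient.
From mathcomp Require Import boolp classical_sets functions cardinality fsbigop.
From mathcomp.multinomials Require Import monalg.

Set Implicit Arguments.
Unset Strict Implicit.
Unset Printing Implicit Defensive.

Import GRing.Theory.

Local Open Scope ring_scope.
Local Open Scope quotient_scope.

(* V ⊗ W is the quotient of the free module on V * W by the submodule spanned
   by the bilinearity relations. *)
Section Tensor.
Variables (K : fieldType) (V W : lmodType K).

Inductive tensor_rel : {malg K[(V * W)%type]} -> Prop :=
| TensorRel0 : tensor_rel 0
| TensorRelD a x y of tensor_rel x & tensor_rel y : tensor_rel (a *: x + y)
| TensorRelL a v v' w :
    tensor_rel (<< (a *: v + v', w) >> - a *: << (v, w) >> - << (v', w) >>)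
| TensorRelR a v w w' :
    tensor_rel (<< (v, a *: w + w') >> - a *: << (v, w) >> - << (v, w') >>).

Definition tensor_relb : {pred {malg K[(V * W)%type]}} := fun x => `[< tensor_rel x >].

Lemma tensor_relP x : reflect (tensor_rel x) (x \in tensor_relb).
Proof. exact: asboolP. Qed.

Fact tensor_rel_zmod : zmod_closed tensor_relb.
Proof.
split=> [|x y /tensor_relP rx /tensor_relP ry]; first exact/tensor_relP/TensorRel0.
apply/tensor_relP; rewrite addrC -scaleN1r; exact: TensorRelD.
Qed.
HB.instance Definition _ :=
  GRing.isZmodClosed.Build {malg K[(V * W)%type]} tensor_relb tensor_rel_zmod.

Definition tensor := Quotient.quot tensor_relb.
HB.instance Definition _ := GRing.Zmodule.on tensor.
HB.instance Definition _ := EqQuotient.on tensor.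

Lemma tensor_eqP (x y : {malg K[(V * W)%type]}) :
  \pi_tensor x = \pi_tensor y <-> tensor_rel (x - y).
Proof.
split=> [/eqP|/tensor_relP xy]; first by rewrite -Quotient.idealrBE => /tensor_relP.
by apply/eqP; rewrite -Quotient.idealrBE.
Qed.

Lemma tensor_piB : {morph \pi_tensor : x y / x - y}.
Proof. exact: (pi_is_zmod_morphism tensor). Qed.
HB.instance Definition _ := GRing.isZmodMorphism.Build
  {malg K[(V * W)%type]} tensor \pi_tensor tensor_piB.

Definition tensor_scale (a : K) (t : tensor) : tensor := \pi_tensor (a *: repr t).

Lemma tensor_piZ a (x : {malg K[(V * W)%type]}) : \pi_tensor (a *: x) = tensor_scale a (\pi_tensor x).
Proof.
apply/tensor_eqP; rewrite -scalerBr -[_ *: _]addr0.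
apply: TensorRelD; last exact: TensorRel0.
by apply/tensor_eqP; rewrite reprK.
Qed.

Fact tensor_scaleA a b t :
  tensor_scale a (tensor_scale b t) = tensor_scale (a * b) t.
Proof. by elim/quotW: t => x; rewrite -(tensor_piZ b) -!tensor_piZ scalerA. Qed.
Fact tensor_scale1 : left_id 1 tensor_scale.
Proof. by elim/quotW=> x; rewrite -!tensor_piZ scale1r. Qed.
Fact tensor_scaleDr : right_distributive tensor_scale +%R.
Proof.
move=> a; elim/quotW=> x; elim/quotW=> y.
rewrite -(tensor_piZ a x) -(tensor_piZ a y) -(raddfD \pi_tensor x y).
by rewrite -(tensor_piZ a (x + y)) scalerDr raddfD.
Qed.
Fact tensor_scaleDl t : {morph tensor_scale^~ t : a b / a + b}.
Proof. by elim/quotW: t => x a b; rewrite -!tensor_piZ scalerDl raddfD. Qed.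
HB.instance Definition _ := GRing.Zmodule_isLmodule.Build K tensor
  tensor_scaleA tensor_scale1 tensor_scaleDr tensor_scaleDl.

Definition tens (v : V) (w : W) : tensor := \pi_tensor << (v, w) >>.

Lemma tensor_piS a x : \pi_tensor (a *: x) = a *: \pi_tensor x.
Proof. exact: tensor_piZ. Qed.

Lemma tens_linear_l w : linear (tens^~ w).
Proof.
move=> a v v'; rewrite /tens -tensor_piS -raddfD /=; apply/tensor_eqP.
by rewrite opprD addrA; exact: TensorRelL.
Qed.

Lemma tens_linear_r v : linear (tens v).
Proof.
move=> a w w'; rewrite /tens -tensor_piS -raddfD /=; apply/tensor_eqP.
by rewrite opprD addrA; exact: TensorRelR.
Qed.

End Tensor.

Notation "v ⊗ w" := (tens v w) (at level 40, left associativity).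

Section TensorLift.
Variables (K : fieldType) (V W U : lmodType K) (b : V -> W -> U).

(* Evaluated on a representative; independent of it when b is bilinear
   (tensor_liftE, tensor_lift_linear). *)
Definition tensor_lift (t : tensor V W) : U :=
  \sum_(p <- msupp (repr t)) (repr t)@_p *: b p.1 p.2.

Hypothesis b_linear_l : forall w, linear (b^~ w).
Hypothesis b_linear_r : forall v, linear (b v).

Let lift (x : {malg K[(V * W)%type]}) : U := \sum_(p <- msupp x) x@_p *: b p.1 p.2.

Let liftEw (d : {fset (V * W)%type}) x : (msupp x `<=` d)%fset ->
  lift x = \sum_(p <- d) x@_p *: b p.1 p.2.
Proof.
move=> le; rewrite /lift (big_fset_incl _ le) // => p _ /mcoeff_outdom ->.
by rewrite scale0r.
Qed.

Let lift_linear : linear lift.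
Proof.
move=> a x y; pose d := (msupp (a *: x + y) `|` (msupp x `|` msupp y))%fset.
rewrite (@liftEw d x) ?(@liftEw d y) ?(@liftEw d (_ + _)) /d ?fsubsetUl //;
  try by apply/fsubsetP=> p; rewrite !inE => ->; rewrite ?orbT.
rewrite scaler_sumr -big_split /=; apply: eq_bigr => p _.
by rewrite mcoeffD mcoeffZ scalerDl scalerA.
Qed.

Let liftU p : lift << p >> = b p.1 p.2.
Proof.
by rewrite (@liftEw [fset p]%fset) ?msuppU_le // big_seq_fset1 mcoeffUU scale1r.
Qed.

Let lift_rel x : tensor_rel x -> lift x = 0.
Proof.
have l0 : lift 0 = 0 by rewrite /lift msupp0 big_seq_fset0.
have lD a u v : lift (a *: u + v) = a *: lift u + lift v by exact: lift_linear.
have lB u a v w : lift (u - a *: v - w) = lift u - a *: lift v - lift w.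
  have -> : u - a *: v - w = -1 *: w + (- a *: v + u).
    by rewrite scaleN1r scaleNr [LHS]addrC (addrC u).
  by rewrite !lD scaleN1r scaleNr [LHS]addrC (addrC (lift u)).
elim=> [|a u v _ u0 _ v0|a v v' w|a v w w'] //.
- by rewrite lD u0 v0 scaler0 addr0.
- rewrite lB !liftU /= b_linear_l; apply/eqP.
  by rewrite -addrA -opprD subr_eq0.
- rewrite lB !liftU /= b_linear_r; apply/eqP.
  by rewrite -addrA -opprD subr_eq0.
Qed.

Let tensor_lift_pi x : tensor_lift (\pi x) = lift x.
Proof.
have /tensor_eqP/lift_rel : \pi_(tensor V W) (repr (\pi_(tensor V W) x)) = \pi x.
  by rewrite reprK.
rewrite -scaleN1r addrC lift_linear scaleN1r addrC => /eqP.
by rewrite subr_eq0 => /eqP.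
Qed.

Lemma tensor_lift_linear : linear tensor_lift.
Proof.
move=> a; elim/quotW=> x; elim/quotW=> y; rewrite -tensor_piS -raddfD.
by rewrite !tensor_lift_pi lift_linear.
Qed.

Lemma tensor_liftE v w : tensor_lift (v ⊗ w) = b v w.
Proof. by rewrite tensor_lift_pi liftU. Qed.

End TensorLift.

Section TensorMap.
Variables (K : fieldType) (V W V' W' : lmodType K).
Variables (f : {linear V -> V'}) (g : {linear W -> W'}).

Definition tensor_map : tensor V W -> tensor V' W' :=
  tensor_lift (fun v w => f v ⊗ g w).

Let map_linear_l w : linear (fun v => f v ⊗ g w).
Proof. by move=> a v v'; rewrite linearP tens_linear_l. Qed.

Let map_linear_r v : linear (fun w => f v ⊗ g w).
Proof. by move=> a w w'; rewrite linearP tens_linear_r. Qed.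

Fact tensor_map_linear : linear tensor_map.
Proof. exact: tensor_lift_linear. Qed.
HB.instance Definition _ :=
  GRing.isLinear.Build K (tensor V W) (tensor V' W') _ tensor_map tensor_map_linear.

Lemma tensor_mapE v w : tensor_map (v ⊗ w) = f v ⊗ g w.
Proof. exact: tensor_liftE. Qed.

End TensorMap.

Section Convolution.
Variables (K : fieldType) (A : algType K).

Definition tensor_mul : tensor A A -> A := tensor_lift *%R.

Fact tensor_mul_linear : linear tensor_mul.
Proof.
by apply: tensor_lift_linear => z a x y; rewrite ?mulrDl ?mulrDr -?scalerAl -?scalerAr.
Qed.
HB.instance Definition _ :=
  GRing.isLinear.Build K (tensor A A) A _ tensor_mul tensor_mul_linear.

Lemma tensor_mulE x y : tensor_mul (x ⊗ y) = x * y.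
Proof.
by apply: tensor_liftE => z a u v; rewrite ?mulrDl ?mulrDr -?scalerAl -?scalerAr.
Qed.

(* S is the convolution inverse of the identity; it is unique if it exists. *)
Definition is_antipode (cop : A -> tensor A A) (eps : A -> K) (S : {linear A -> A}) :=
  (forall x, tensor_mul (tensor_map S idfun (cop x)) = (eps x)%:A) /\
  (forall x, tensor_mul (tensor_map idfun S (cop x)) = (eps x)%:A).

End Convolution.

Definition hopf_morphism (K : fieldType) (A B : algType K)
    (copA : A -> tensor A A) (epsA : A -> K)
    (copB : B -> tensor B B) (epsB : B -> K) (phi : {linear A -> B}) : Prop :=
  [/\ phi 1 = 1,
      {morph phi : x y / x * y},
      forall x, tensor_map phi phi (copA x) = copB (phi x),
      forall x, epsB (phi x) = epsA x
    & forall (SA : {linear A -> A}) (SB : {linear B -> B}),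
        is_antipode copA epsA SA -> is_antipode copB epsB SB ->
        forall x, phi (SA x) = SB (phi x)].

Definition is_topology (E : finType) (T : {set {set E}}) : bool :=
  [&& finset.set0 \in T, [set: E]%SET \in T,
      [forall A in T, forall B in T, A :&: B \in T]
    & [forall C : {set {set E}}, (C \subset T) ==> (finset.cover C \in T)]].

Record topology (E : finType) :=
  Topology { opens : {set {set E}}; opensP : is_topology opens }.

HB.instance Definition _ (E : finType) := [isSub for @opens E].
HB.instance Definition _ (E : finType) := [Finite of topology E by <:].

Section TopologyTheory.
Variable (E : finType).
Implicit Type T : topology E.

Lemma open0 T : finset.set0 \in opens T.
Proof. by case/and4P: (opensP T). Qed.

Lemma openT T : [set: E]%SET \in opens T.
Proof. by case/and4P: (opensP T). Qed.

Lemma openI T A B : A \in opens T -> B \in opens T -> A :&: B \in opens T.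
Proof.
move=> AT BT; case/and4P: (opensP T) => _ _ h _.
by move/forallP/(_ A): h; rewrite AT => /forallP/(_ B); rewrite BT.
Qed.

Lemma open_cover T (C : {set {set E}}) : C \subset opens T -> finset.cover C \in opens T.
Proof. by move=> CT; case/and4P: (opensP T) => _ _ _ /forallP/(_ C); rewrite CT. Qed.

Lemma is_topologyP (T : {set {set E}}) :
  [/\ finset.set0 \in T, [set: E]%SET \in T,
      forall A B, A \in T -> B \in T -> A :&: B \in T
    & forall C : {set {set E}}, C \subset T -> finset.cover C \in T] -> is_topology T.
Proof.
case=> T0 T1 TI TU; apply/and4P; split=> //.
  by apply/forallP=> A; apply/implyP=> AT; apply/forallP=> B; apply/implyP; exact: TI.
by apply/forallP=> C; apply/implyP; exact: TU.
Qed.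

Lemma topologyP T T' : (forall O, (O \in opens T) = (O \in opens T')) -> T = T'.
Proof. by move=> h; apply/val_inj/setP. Qed.

End TopologyTheory.

Fact pullback_subproof (E E' : finType) (f : E' -> E) (T : topology E) :
  is_topology [set f @^-1: O | O : {set E} in opens T].
Proof.
apply: is_topologyP; split.
- by apply/imsetP; exists finset.set0; rewrite ?open0 // preimset0.
- by apply/imsetP; exists [set: E]%SET; rewrite ?openT // preimsetT.
- move=> _ _ /imsetP[A AT ->] /imsetP[B BT ->]; rewrite -preimsetI.
  by apply/imset_f/openI.
- move=> C /fintype.subsetP CT; pose D := [set O in opens T | f @^-1: O \in C].
  have -> : finset.cover C = f @^-1: finset.cover D.
    apply/setP=> x; rewrite inE; apply/bigcupP/bigcupP => [[B BC xB]|[O]].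
      have /imsetP[O OT BE] := CT _ BC; exists O; first by rewrite !inE OT -BE.
      by move: xB; rewrite BE inE.
    by rewrite inE => /andP[OT OC] xO; exists (f @^-1: O); rewrite ?inE.
  apply/imset_f/open_cover; apply/fintype.subsetP=> O; rewrite inE; by case/andP.
Qed.

Definition pullback (E E' : finType) (f : E' -> E) (T : topology E) : topology E' :=
  Topology (pullback_subproof f T).

(* The open sets of the induced topology are the traces O ∩ Y, which on the
   subtype are the preimages of the O by the inclusion. *)
Definition induced (E : finType) (T : topology E) (Y : {set E}) :
  topology {x : E | x \in Y} := pullback val T.

Fact sum_topology_subproof (E E' : finType) (T : topology E) (T' : topology E') :
  is_topology [set O : {set E + E'} |
                (inl @^-1: O \in opens T) && (inr @^-1: O \in opens T')].
Proof.
apply: is_topologyP; split.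
- by rewrite inE !preimset0 !open0.
- by rewrite inE !preimsetT !openT.
- move=> A B; rewrite !inE !preimsetI => /andP[A1 A2] /andP[B1 B2].
  by rewrite !openI.
- move=> C /fintype.subsetP CT.
  have pc (F : finType) (i : F -> E + E') (S : topology F) :
      (forall O, O \in C -> i @^-1: O \in opens S) -> i @^-1: finset.cover C \in opens S.
    move=> h; have -> : i @^-1: finset.cover C = finset.cover [set i @^-1: O | O : {set E + E'} in C].
      apply/setP=> x; rewrite inE cover_imset; apply/bigcupP/bigcupP=> -[O OC xO];
        exists O => //; by rewrite inE in xO *.
    by apply: open_cover; apply/fintype.subsetP=> _ /imsetP[O OC ->]; exact: h.
  by rewrite inE !pc // => O /CT; rewrite inE => /andP[].
Qed.

Definition sum_topology (E E' : finType) (T : topology E) (T' : topology E') :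
  topology (E + E')%type := Topology (sum_topology_subproof T T').

Fact void_topology_subproof : is_topology [set: {set void}]%SET.
Proof. by apply: is_topologyP; split=> *; rewrite inE. Qed.
Definition void_topology : topology void := Topology void_topology_subproof.

Definition homeomorphic (E E' : finType) (T : topology E) (T' : topology E') : Prop :=
  exists2 f : E -> E', bijective f
    & forall O : {set E'}, (f @^-1: O \in opens T) = (O \in opens T').

Section Homeomorphic.

Lemma homeo_refl (E : finType) (T : topology E) : homeomorphic T T.
Proof.
exists id => [|O]; first by exists id.
by have -> : id @^-1: O = O by apply/setP=> x; rewrite inE.
Qed.

Lemma homeo_sym (E E' : finType) (T : topology E) (T' : topology E') :
  homeomorphic T T' -> homeomorphic T' T.
Proof.
case=> f [g fK gK] fT; exists g => [|O]; first by exists f.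
rewrite -fT; have -> // : f @^-1: (g @^-1: O) = O.
by apply/setP=> x; rewrite !inE fK.
Qed.

Lemma homeo_trans (E1 E2 E3 : finType)
    (T1 : topology E1) (T2 : topology E2) (T3 : topology E3) :
  homeomorphic T1 T2 -> homeomorphic T2 T3 -> homeomorphic T1 T3.
Proof.
case=> f fb fT [g gb gT]; exists (g \o f) => [|O]; first exact: bij_comp.
rewrite -gT -fT; have -> // : (g \o f) @^-1: O = f @^-1: (g @^-1: O).
by apply/setP=> x; rewrite !inE.
Qed.

Lemma homeo_pullback (E E' : finType) (f : E' -> E) (T : topology E) :
  bijective f -> homeomorphic (pullback f T) T.
Proof.
move=> fb; exists f => // O; apply/imsetP/idP => [[O' O'T OO']|OT]; last by exists O.
case: fb => g fK gK; suff -> : O = O' by [].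
by apply/setP=> x; move/setP/(_ (g x)): OO'; rewrite !inE gK.
Qed.

Lemma homeo_sum (E1 E2 F1 F2 : finType) (T1 : topology E1) (T2 : topology E2)
    (S1 : topology F1) (S2 : topology F2) :
  homeomorphic T1 S1 -> homeomorphic T2 S2 ->
  homeomorphic (sum_topology T1 T2) (sum_topology S1 S2).
Proof.
case=> f [f' fK f'K] fT [g [g' gK g'K] gT].
exists (fun x => match x with inl a => inl (f a) | inr b => inr (g b) end).
  by exists (fun x => match x with inl a => inl (f' a) | inr b => inr (g' b) end);
    case=> x; rewrite ?(fK, f'K, gK, g'K).
move=> O; rewrite !inE -fT -gT.
by congr (_ && _); congr (_ \in opens _); apply/setP=> x; rewrite !inE.
Qed.

Lemma homeo_induced (E E' : finType) (T : topology E) (T' : topology E')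
    (f : E -> E') (Y : {set E'}) :
  bijective f -> (forall O : {set E'}, (f @^-1: O \in opens T) = (O \in opens T')) ->
  homeomorphic (induced T (f @^-1: Y)) (induced T' Y).
Proof.
move=> [g fK gK] fT.
have fP (x : {x | x \in f @^-1: Y}) : f (val x) \in Y by case: x => x /=; rewrite inE.
have gP (y : {y | y \in Y}) : g (val y) \in f @^-1: Y by case: y => y /=; rewrite inE gK.
pose F x : {y | y \in Y} := Sub (f (val x)) (fP x).
pose G y : {x | x \in f @^-1: Y} := Sub (g (val y)) (gP y).
have FK : cancel F G by move=> x; apply: val_inj; rewrite /= fK.
have GK : cancel G F by move=> y; apply: val_inj; rewrite /= gK.
exists F => [|O]; first by exists G.
apply/imsetP/imsetP => [[U UT FU]|[V VT ->]].
  exists (g @^-1: U).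
    rewrite -fT; suff -> : f @^-1: (g @^-1: U) = U by [].
    by apply/setP=> x; rewrite !inE fK.
  by apply/setP=> y; move/setP/(_ (G y)): FU; rewrite !inE GK.
exists (f @^-1: V); first by rewrite fT.
by apply/setP=> x; rewrite !inE.
Qed.

End Homeomorphic.

(* Every finite space is homeomorphic to a topology on some 'I_n, so the
   homeomorphism classes form the quotient of this type. *)
Definition std_space := {n : nat & topology 'I_n}.

Definition homeob (S S' : std_space) : bool :=
  `[< homeomorphic (tagged S) (tagged S') >].

Fact homeob_equiv : equiv_class_of homeob.
Proof.
split=> [S|S S'|S2 S1 S3].
- exact/asboolP/homeo_refl.
- by apply/asboolP/asboolP; exact: homeo_sym.
- by move=> /asboolP h /asboolP h'; apply/asboolP; exact: homeo_trans h h'.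
Qed.
Canonical homeob_equivRel := EquivRelPack homeob_equiv.
Canonical homeob_encModRel := defaultEncModRel homeob.

Definition finspace := {eq_quot homeob}.
HB.instance Definition _ := Choice.on finspace.
HB.instance Definition _ := EqQuotient.on finspace.

Definition finclass (E : finType) (T : topology E) : finspace :=
  \pi_finspace (Tagged (fun n => topology 'I_n)
    (pullback (fun i : 'I_#|E| => enum_val i) T)).

Lemma finclassP (E E' : finType) (T : topology E) (T' : topology E') :
  finclass T = finclass T' <-> homeomorphic T T'.
Proof.
have hE (F : finType) (S : topology F) :
    homeomorphic (pullback (fun i : 'I_#|F| => enum_val i) S) S.
  by apply: homeo_pullback; exact: enum_val_bij.
split=> [/eqmodP/asboolP /= h|h].
  exact: homeo_trans (homeo_sym (hE _ T)) (homeo_trans h (hE _ T')).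
apply/eqmodP/asboolP.
exact: homeo_trans (hE _ T) (homeo_trans h (homeo_sym (hE _ T'))).
Qed.

Lemma finclass_repr (s : finspace) : finclass (tagged (repr s)) = s.
Proof.
rewrite -[s in RHS]reprK; apply/eqmodP/asboolP.
by apply: homeo_pullback; exact: enum_val_bij.
Qed.

Lemma finspaceW (P : finspace -> Prop) :
  (forall (E : finType) (T : topology E), P (finclass T)) -> forall s, P s.
Proof. by move=> h s; rewrite -(finclass_repr s); exact: h. Qed.

Definition fs_one : finspace := finclass void_topology.

Definition fs_mul (s t : finspace) : finspace :=
  finclass (sum_topology (tagged (repr s)) (tagged (repr t))).

Lemma fs_mulE (E E' : finType) (T : topology E) (T' : topology E') :
  fs_mul (finclass T) (finclass T') = finclass (sum_topology T T').
Proof. by apply/finclassP/homeo_sum; apply/finclassP; rewrite finclass_repr. Qed.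

Fact fs_mulA : associative fs_mul.
Proof.
elim/finspaceW=> E1 T1; elim/finspaceW=> E2 T2; elim/finspaceW=> E3 T3.
rewrite !fs_mulE; apply/finclassP.
exists (fun x => match x with
  | inl a => inl (inl a) | inr (inl b) => inl (inr b) | inr (inr c) => inr c end).
  exists (fun x => match x with
    | inl (inl a) => inl a | inl (inr b) => inr (inl b) | inr c => inr (inr c) end);
    by [case=> [|[]] | case=> [[]|]].
move=> O; rewrite !inE -andbA.
by congr [&& _, _ & _]; congr (_ \in opens _); apply/setP=> x; rewrite !inE.
Qed.

Fact fs_mulC : commutative fs_mul.
Proof.
elim/finspaceW=> E1 T1; elim/finspaceW=> E2 T2.
rewrite !fs_mulE; apply/finclassP.
exists (fun x => match x with inl a => inr a | inr b => inl b end).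
  by exists (fun x => match x with inl a => inr a | inr b => inl b end); case.
move=> O; rewrite !inE andbC.
by congr (_ && _); congr (_ \in opens _); apply/setP=> x; rewrite !inE.
Qed.

Fact fs_mul1 : left_id fs_one fs_mul.
Proof.
elim/finspaceW=> E T; rewrite fs_mulE; apply/finclassP.
exists (fun x : void + E => match x with inl a => match a with end | inr b => b end).
  by exists inr => // -[].
move=> O; rewrite !inE /=.
by congr (_ \in opens _); apply/setP=> x; rewrite !inE.
Qed.

Fact fs_mulr1 : right_id fs_one fs_mul.
Proof. by move=> s; rewrite fs_mulC fs_mul1. Qed.

Lemma finclass_eq1 (E : finType) (T : topology E) : finclass T = fs_one <-> #|E| = 0%N.
Proof.
split=> [/finclassP[f /bij_eq_card -> _]|E0]; first exact: card_void.
have E0' (x : E) : False by have := fintype0 x E0.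
apply/finclassP; exists (fun x => match E0' x with end).
  by exists (fun v : void => match v with end) => [x|[]]; case: (E0' x).
move=> O; rewrite inE; have -> : opens T = [set: {set E}]%SET; last by rewrite inE.
apply/setP=> A; rewrite inE; suff -> : A = finset.set0 by rewrite open0.
by apply/setP=> x; case: (E0' x).
Qed.

Fact fs_unit s t : fs_mul s t = fs_one -> s = fs_one /\ t = fs_one.
Proof.
elim/finspaceW: s => E T; elim/finspaceW: t => E' T'.
rewrite fs_mulE => /finclass_eq1/eqP; rewrite card_sum addn_eq0 => /andP[/eqP h /eqP h'].
by split; apply/finclass_eq1.
Qed.

HB.instance Definition _ := Choice_isMonomialDef.Build finspace
  fs_mulA fs_mul1 fs_mulr1 fs_unit.
HB.instance Definition _ := MonomialDef_isConomialDef.Build finspace fs_mulC.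

Section FSpace.
Variable K : fieldType.

(* The product of {malg K[finspace]} extends bilinearly the monoid law fs_mul,
   that is, disjoint union (fs_mulE). *)
Definition FSpace := {malg K[finspace]}.
HB.instance Definition _ := GRing.ComAlgebra.on FSpace.

Definition fsb (s : finspace) : FSpace := << s >>.

(* Computed on the canonical representative of the class; fs_coprodE gives the
   value for an arbitrary topology in the class. *)
Definition fs_coprod_basis (s : finspace) : tensor FSpace FSpace :=
  let T := tagged (repr s) in
  \sum_(O in opens T)
    fsb (finclass (induced T (~: O))) ⊗ fsb (finclass (induced T O)).

Definition fs_coprod (x : FSpace) : tensor FSpace FSpace :=
  \sum_(s <- msupp x) x@_s *: fs_coprod_basis s.

(* The counit of a connected graded coalgebra: 1 on the empty space, 0 on the
   other finite spaces. *)
Definition fs_counit (x : FSpace) : K := x@_fs_one.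

Lemma fs_coprodEw (d : {fset finspace}) (x : FSpace) : (msupp x `<=` d)%fset ->
  fs_coprod x = \sum_(s <- d) x@_s *: fs_coprod_basis s.
Proof.
move=> le; rewrite /fs_coprod (big_fset_incl _ le) // => p _ /mcoeff_outdom ->.
by rewrite scale0r.
Qed.

Fact fs_coprod_linear : linear fs_coprod.
Proof.
move=> a x y; pose d := (msupp (a *: x + y) `|` (msupp x `|` msupp y))%fset.
rewrite (@fs_coprodEw d x) ?(@fs_coprodEw d y) ?(@fs_coprodEw d (_ + _)) /d
  ?fsubsetUl //; try by apply/fsubsetP=> p; rewrite !inE => ->; rewrite ?orbT.
rewrite scaler_sumr -big_split /=; apply: eq_bigr => p _.
by rewrite mcoeffD mcoeffZ scalerDl scalerA.
Qed.
HB.instance Definition _ :=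
  GRing.isLinear.Build K FSpace (tensor FSpace FSpace) _ fs_coprod fs_coprod_linear.

Lemma fs_coprodE (E : finType) (T : topology E) :
  fs_coprod (fsb (finclass T)) =
  \sum_(O in opens T)
    fsb (finclass (induced T (~: O))) ⊗ fsb (finclass (induced T O)).
Proof.
rewrite (@fs_coprodEw [fset finclass T]%fset) ?msuppU_le //.
rewrite big_seq_fset1 mcoeffUU scale1r /fs_coprod_basis.
set S := tagged _; have /finclassP : finclass T = finclass S by rewrite finclass_repr.
case=> f fb fT; have [g fK gK] := fb.
pose f' (O : {set 'I_(tag (repr (finclass T)))}) := f @^-1: O.
have f'bij : bijective f'.
  exists (fun O : {set E} => g @^-1: O) => O; apply/setP=> x.
    by rewrite !inE gK.
  by rewrite !inE fK.
rewrite [RHS](reindex f') /=; last exact: onW_bij.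
apply: eq_big => [O|O _]; first by rewrite fT.
have hr (Y : {set 'I_(tag (repr (finclass T)))}) :
    finclass (induced T (f @^-1: Y)) = finclass (induced S Y).
  by apply/finclassP; exact: (homeo_induced _ fb fT).
have -> : ~: f' O = f @^-1: (~: O) by rewrite preimsetC.
rewrite (hr O).
by rewrite !hr.
Qed.

End FSpace.
Record posn := Posn { posn_val :> nat; posn_gt0 : (0 < posn_val)%N }.
HB.instance Definition _ := [isSub for posn_val].
HB.instance Definition _ := [Countable of posn by <:].

Definition posnS (k : nat) : posn := Posn (ltn0Sn k).

(* x_(i 0) ^ a_0 * x_(i 1) ^ a_1 * ..., with exponents read from 0. *)
Definition imonom (i : nat -> posn) (a : seq nat) : {cmonom posn} :=
  \big[mmul/mone]_(k < size a) expcmn (ucm (i k)) (nth 0%N a k).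

Section Monomials.
Implicit Types (m : {cmonom posn}) (g : posn -> posn).

Lemma expcmnE m n p : expcmn m n p = (n * m p)%N.
Proof.
rewrite /expcmn; case: n => [|n]; first by rewrite /= onecmE.
rewrite iteropS; elim: n => [|n IH]; first by rewrite mul1n.
by rewrite iterS mulcmE IH mulSn.
Qed.

Lemma big_cmE (J : Type) (r : seq J) (P : pred J) (F : J -> {cmonom posn}) p :
  (\big[mmul/mone]_(j <- r | P j) F j) p = (\sum_(j <- r | P j) F j p)%N.
Proof. by apply: (big_morph (fun m : {cmonom posn} => m p)) => [x y|]; rewrite ?cmM ?cm1. Qed.

Lemma imonomE i a p : imonom i a p = (\sum_(k < size a) nth 0 a k * (i k == p))%N.
Proof. by rewrite big_cmE; apply: eq_bigr => k _; rewrite expcmnE ucmE. Qed.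

Definition relabel g m : {cmonom posn} :=
  \big[mmul/mone]_(i <- finsupp m) expcmn (ucm (g i)) (m i).

Lemma relabelEw (d : {fset posn}) g m p : (finsupp m `<=` d)%fset ->
  relabel g m p = (\sum_(i <- d) m i * (g i == p))%N.
Proof.
move=> le; rewrite big_cmE (big_fset_incl _ le).
  by apply: eq_bigr => i _; rewrite expcmnE ucmE.
by move=> i _ /fsfun_dflt mi; rewrite expcmnE mi.
Qed.

Lemma relabelM g : {morph relabel g : m1 m2 / mmul m1 m2}.
Proof.
move=> m1 m2; apply/eqP/cmP=> p; rewrite cmM.
rewrite (@relabelEw (finsupp m1 `|` finsupp m2)%fset _ _ p) ?mdomD //.
rewrite (@relabelEw (finsupp m1 `|` finsupp m2)%fset _ m1 p) ?fsubsetUl //.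
rewrite (@relabelEw (finsupp m1 `|` finsupp m2)%fset _ m2 p) ?fsubsetUr //.
by rewrite -big_split /=; apply: eq_bigr => i _; rewrite cmM mulnDl.
Qed.

Lemma relabel1 g : relabel g mone = mone.
Proof. by rewrite /relabel mdom1 big_seq_fset0. Qed.

Lemma relabelU g i : relabel g (ucm i) = ucm (g i).
Proof.
apply/eqP/cmP=> p; rewrite (@relabelEw [fset i]%fset) ?mdomU // big_seq_fset1.
by rewrite !ucmE eqxx mul1n.
Qed.

Lemma relabelX g m n : relabel g (expcmn m n) = expcmn (relabel g m) n.
Proof.
rewrite /expcmn; case: n => [|n]; first exact: relabel1.
by rewrite !iteropS; elim: n => [//|n IH]; rewrite !iterS relabelM IH.
Qed.

Lemma relabel_imonom g i a : relabel g (imonom i a) = imonom (g \o i) a.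
Proof.
rewrite /imonom (big_morph _ (relabelM g) (relabel1 g)).
by apply: eq_bigr => k _; rewrite relabelX relabelU.
Qed.

Lemma relabelE g m i : injective g -> relabel g m (g i) = m i.
Proof.
move=> gI; rewrite (@relabelEw (i |` finsupp m)%fset) ?fsubsetU1 //.
rewrite (big_fsetD1 i) ?fset1U1 //= eqxx muln1 big1_fset ?addn0 // => j.
by rewrite !inE (inj_eq gI) => /andP[/negPf -> _]; rewrite muln0.
Qed.

Lemma relabelN g m p : (forall i, g i != p) -> relabel g m p = 0%N.
Proof.
move=> gp; rewrite (@relabelEw (finsupp m)) // big1_fset // => i _ _.
by rewrite (negPf (gp i)) muln0.
Qed.

Lemma relabel_inj g : injective g -> injective (relabel g).
Proof.
by move=> gI m m' mm'; apply/eqP/cmP=> i; rewrite -!(relabelE _ i gI) mm'.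
Qed.

Lemma mdegX m n : mdeg (expcmn m n) = (n * mdeg m)%N.
Proof.
rewrite /expcmn; case: n => [|n]; first exact: mdeg1.
rewrite iteropS; elim: n => [|n IH]; first by rewrite mul1n.
by rewrite iterS mdegM IH mulSn.
Qed.

Lemma mdeg_relabel g m : mdeg (relabel g m) = mdeg m.
Proof.
by rewrite mdeg_prod mdegE; apply: eq_bigr => i _; rewrite mdegX mdegU muln1.
Qed.

Lemma mdeg_imonom i a : mdeg (imonom i a) = sumn a.
Proof.
rewrite mdeg_prod sumnE (big_nth 0%N) big_mkord.
by apply: eq_bigr => k _; rewrite mdegX mdegU muln1.
Qed.

Lemma imonom_onto m : exists a, m = imonom posnS a.
Proof.
pose N := (\max_(i <- finsupp m) i)%N.
exists (mkseq (fun k => m (posnS k)) N); apply/eqP/cmP=> p.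
rewrite imonomE size_mkseq; case: (leqP p N) => pN.
  have p1N : (p.-1 < N)%N by rewrite prednK ?posn_gt0.
  have pE : posnS p.-1 = p by apply: val_inj; rewrite /= prednK ?posn_gt0.
  rewrite (bigD1 (Ordinal p1N)) //= nth_mkseq // pE eqxx muln1 big1 ?addn0 //.
  move=> k kp; case: eqP => [kE|]; rewrite ?muln0 //.
  by case/eqP: kp; apply: val_inj; rewrite /= -kE.
rewrite big1 => [|k _].
  apply: fsfun_dflt; apply/negP=> pm; move: pN; rewrite ltnNge => /negP; apply.
  by rewrite /N; exact: (@leq_bigmax_seq _ _ _ (fun i : posn => i : nat)).
case: eqP => [kE|]; rewrite ?muln0 //.
by move: pN; rewrite -kE /= ltnNge ltn_ord.
Qed.

Lemma relabel_surj g m a b : injective g -> mmul a b = relabel g m ->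
  exists2 c, a = relabel g c & exists2 d, b = relabel g d & mmul c d = m.
Proof.
move=> gI abm.
have key (a' b' : {cmonom posn}) : mmul a' b' = relabel g m -> exists c, a' = relabel g c.
  move=> abm'; have le p : (a' p <= relabel g m p)%N by rewrite -abm' cmM leq_addr.
  exists [cmonom a' (g i) | i in finsupp m]%M; apply/eqP/cmP=> p.
  have [[i <-]|np] := pselect (exists i, g i = p).
    rewrite relabelE // cmE fsfun_fun; case: ifP => // /negbT im.
    by have := le (g i); rewrite relabelE // (fsfun_dflt im) leqn0 => /eqP.
  have gp i : g i != p by apply/eqP=> gip; apply: np; exists i.
  by have := le p; rewrite !relabelN // leqn0 => /eqP.
have [c ac] := key _ _ abm; have [d bd] := key b a (etrans (mulmC _ _) abm).
exists c => //; exists d => //; apply: (relabel_inj gI).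
by rewrite relabelM -ac -bd.
Qed.

Definition mdivs m : set {cmonom posn} := [set a | exists b, mmul a b = m]%classic.

Lemma finite_mdivs m : finite_set (mdivs m).
Proof.
pose F (h : {ffun finsupp m -> 'I_(mdeg m).+1}) : {cmonom posn} :=
  [cmonom if insub i is Some x then h x : nat else 0%N | i in finsupp m]%M.
apply: (@sub_finite_set _ _ (F @` [set: _])%classic); last first.
  exact/finite_image/finite_finset.
move=> a [b abm]; exists [ffun x => inord (a (val x))] => //.
apply/eqP/cmP=> p; rewrite /F cmE fsfun_fun.
have ap : (a p <= m p)%N by rewrite -abm cmM leq_addr.
case: ifP => [pm|/negbT pm]; last first.
  by move: ap; rewrite (fsfun_dflt pm) leqn0 => /eqP.
rewrite insubT ffunE /= inordK // ltnS (leq_trans ap) //.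
by rewrite mdegE (big_fsetD1 p) //= leq_addr.
Qed.

Definition mdivf m : {fset {cmonom posn}} := fset_set (mdivs m).

Lemma mdivfP m a : reflect (exists b, mmul a b = m) (a \in mdivf m).
Proof.
rewrite in_fset_set; last exact: finite_mdivs.
by apply: (iffP idP) => [/set_mem|?]; [|apply/mem_set].
Qed.

Lemma mdivf_trans m a b : a \in mdivf m -> b \in mdivf a -> b \in mdivf m.
Proof.
move=> /mdivfP[c <-] /mdivfP[d <-]; apply/mdivfP; exists (mmul d c).
by rewrite mulmA.
Qed.

End Monomials.

Section Series.
Variable K : fieldType.

(* Formal power series in the variables x_1, x_2, ..., as coefficient functions;
   K^o only provides the module structure. The product installed on this type
   is series_mul, not the pointwise one. *)
Definition series := {cmonom posn} -> K^o.
HB.instance Definition _ := Choice.copy series ({cmonom posn} -> K^o).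
HB.instance Definition _ := GRing.Zmodule.copy series ({cmonom posn} -> K^o).
HB.instance Definition _ := GRing.Lmodule.copy series ({cmonom posn} -> K^o).

Implicit Types (s t u : series) (m : {cmonom posn}).

Lemma seriesP s t : (forall m, s m = t m) -> s = t.
Proof. by move=> st; apply/funext. Qed.

Definition series_one : series := fun m => (m == mone)%:R.

Definition series_mul s t : series := fun m =>
  \sum_(p \in [set p : {cmonom posn} * {cmonom posn} | mmul p.1 p.2 = m]%classic)
    s p.1 * t p.2.

Let trunc m s : {malg K[{cmonom posn}]} := [malg a in mdivf m => s a].

Let truncE m s a : a \in mdivf m -> s a = (trunc m s)@_a.
Proof. by move=> am; rewrite mcoeffE am. Qed.

Let mul_agree s t (g h : {malg K[{cmonom posn}]}) m :
  (forall a, a \in mdivf m -> s a = g@_a) ->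
  (forall a, a \in mdivf m -> t a = h@_a) ->
  series_mul s t m = (g * h)@_m.
Proof.
move=> sg th; rewrite /series_mul.
pose D := mdivf m; pose dg := (D `|` msupp g)%fset; pose dh := (D `|` msupp h)%fset.
have mD a b : mmul a b = m -> (a \in D) * (b \in D).
  by move=> ab; split; apply/mdivfP; [exists b|exists a; rewrite mulmC].
rewrite (@mcoeffMlw _ _ dg dh) ?fsubsetUr //.
have -> : \sum_(k1 <- dg) \sum_(k2 <- dh) g@_k1 * h@_k2 *+ (mmul k1 k2 == m)
    = \sum_(k1 <- D) \sum_(k2 <- D) g@_k1 * h@_k2 *+ (mmul k1 k2 == m).
  rewrite -(big_fset_incl _ (fsubsetUl D (msupp g))) => [|a _ aD]; last first.
    by rewrite big1_fset // => b _ _; case: eqP => // /mD[aD']; rewrite aD' in aD.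
  apply: eq_bigr => a _.
  rewrite -(big_fset_incl _ (fsubsetUl D (msupp h))) // => b _ bD.
  by case: eqP => // /mD[_ bD']; rewrite bD' in bD.
rewrite /D /mdivf -(fsbig_finite _ _ (finite_mdivs m)).
under eq_fsbigr do rewrite -(fsbig_finite _ _ (finite_mdivs m)).
rewrite pair_fsbig; try exact: finite_mdivs.
under [RHS]eq_fsbigr => p.
  move=> /set_mem[/= p1 p2].
  rewrite -sg -?th; try by rewrite in_fset_set ?inE //; exact: finite_mdivs.
  over.
rewrite /=.
transitivity (\sum_(p \in [set p : {cmonom posn} * {cmonom posn} | mmul p.1 p.2 = m]%classic)
    (s p.1 * t p.2 *+ (mmul p.1 p.2 == m))).
  by apply: eq_fsbigr => p /set_mem /= ->; rewrite eqxx.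
apply: fsbig_widen => [[a b] /= ab|[a b] [_ /= abm]].
  by split; [exists b|exists a; rewrite mulmC].
by rewrite /=; case: eqP abm.
Qed.

Let mul_trunc s t m : series_mul s t m = (trunc m s * trunc m t)@_m.
Proof. by apply: mul_agree => a am; exact: truncE. Qed.

Fact series_mulA : associative series_mul.
Proof.
move=> s t u; apply: seriesP => m.
have st a : a \in mdivf m -> series_mul s t a = (trunc m s * trunc m t)@_a.
  by move=> am; apply: mul_agree => b ba; apply/truncE/(mdivf_trans am).
have tu a : a \in mdivf m -> series_mul t u a = (trunc m t * trunc m u)@_a.
  by move=> am; apply: mul_agree => b ba; apply/truncE/(mdivf_trans am).
rewrite (mul_agree (truncE s) tu) (mul_agree st (truncE u)).
by rewrite mulrA.
Qed.

Fact series_mulC : commutative series_mul.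
Proof. by move=> s t; apply: seriesP => m; rewrite !mul_trunc mulrC. Qed.

Fact series_mul1 : left_id series_one series_mul.
Proof.
move=> s; apply: seriesP => m.
rewrite (@mul_agree _ _ 1 (trunc m s) m) ?mul1r => [|a _|a]; last exact: truncE.
  by rewrite -truncE //; apply/mdivfP; exists mone; rewrite mulm1.
by rewrite mcoeff1.
Qed.

Fact series_mulDl : left_distributive series_mul +%R.
Proof.
move=> s t u; apply: seriesP => m.
have -> : (series_mul s u + series_mul t u) m = series_mul s u m + series_mul t u m.
  by [].
rewrite (@mul_agree _ _ (trunc m s + trunc m t) (trunc m u) m) => [|a am|a am].
- by rewrite (mulrDl (trunc m s) (trunc m t) (trunc m u)) mcoeffD
    (mul_trunc s u m) (mul_trunc t u m).
- by rewrite mcoeffD -(truncE s am) -(truncE t am).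
- exact: truncE.
Qed.

Fact series_one_neq0 : series_one != 0.
Proof.
apply/eqP => /(congr1 (fun s : series => s mone)).
by rewrite /series_one eqxx => /eqP; rewrite oner_eq0.
Qed.

HB.instance Definition _ := GRing.Zmodule_isComNzRing.Build series
  series_mulA series_mulC series_mul1 series_mulDl series_one_neq0.

Fact series_scaleAl (a : K) s t : a *: (s * t) = (a *: s) * t.
Proof.
apply: seriesP => m.
rewrite [RHS](@mul_agree _ _ (a *: trunc m s) (trunc m t) m) => [|b bm|b bm].
- by rewrite -scalerAl mcoeffZ -mul_trunc.
- by rewrite mcoeffZ -truncE.
- exact: truncE.
Qed.
HB.instance Definition _ := GRing.Lmodule_isLalgebra.Build K series series_scaleAl.
HB.instance Definition _ := GRing.Lalgebra_isComAlgebra.Build K series.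

Definition smonom (m0 : {cmonom posn}) : series := fun m => (m == m0)%:R.

Definition svar (i : posn) : series := smonom (ucm i).

Lemma smonomM a b : smonom a * smonom b = smonom (mmul a b).
Proof.
apply: seriesP => m; rewrite [LHS](@mul_agree _ _ << a >> << b >> m) => [|c _|c _].
- by rewrite malgM_def fgmulUU mul1r mcoeffU1 eq_sym.
- by rewrite mcoeffU1 eq_sym.
- by rewrite mcoeffU1 eq_sym.
Qed.

Lemma smonom1 : smonom mone = 1. Proof. by []. Qed.

Lemma smonomX m n : smonom m ^+ n = smonom (expcmn m n).
Proof.
rewrite /expcmn; case: n => [|n]; first by rewrite expr0 -smonom1.
by rewrite iteropS; elim: n => [//|n IH]; rewrite exprS IH iterS smonomM.
Qed.

Lemma smonom_prod (J : Type) (r : seq J) (P : pred J) (F : J -> {cmonom posn}) :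
  \prod_(j <- r | P j) smonom (F j) = smonom (\big[mmul/mone]_(j <- r | P j) F j).
Proof.
by apply/esym/(big_morph smonom) => [x y|]; rewrite ?smonomM ?smonom1.
Qed.

(* Formal sum of a family in which each monomial has a nonzero coefficient in
   finitely many terms only (a coefficient violating this would be 0). *)
Definition series_sum (J : choiceType) (D : set J) (F : J -> series) : series :=
  fun m => \sum_(j \in D) F j m.

Definition increasing (g : posn -> posn) : Prop :=
  forall i j : posn, (i < j)%N -> (g i < g j)%N.

Definition bounded_degree s : Prop :=
  exists d : nat, forall m, (d < mdeg m)%N -> s m = 0.

(* Since posnS k = k + 1, these are the coefficients of x_1^a_1 ... x_n^a_n and
   of x_g(1)^a_1 ... x_g(n)^a_n; the a_k may be 0. *)
Definition quasisymmetric s : Prop :=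
  forall g : posn -> posn, increasing g ->
  forall a : seq nat, s (imonom posnS a) = s (imonom (g \o posnS) a).

Definition is_qsym : {pred series} :=
  fun s => `[< bounded_degree s /\ quasisymmetric s >].

Lemma incr_inj (g : posn -> posn) : increasing g -> injective g.
Proof.
move=> gI i j gij; apply: val_inj => /=.
by case: (ltngtP i j) => // /gI; rewrite gij ltnn.
Qed.

Lemma qsymP s : quasisymmetric s <->
  forall g : posn -> posn, increasing g ->
  forall m, s (relabel g m) = s m.
Proof.
split=> qs g gI => [m|a]; last by rewrite -relabel_imonom qs.
by have [a ->] := imonom_onto m; rewrite relabel_imonom -qs.
Qed.

Fact is_qsym_subalg : GRing.subsemialg_closed is_qsym.
Proof.
split=> [|||s t /asboolP[[d sd] /qsymP sq] /asboolP[[e te] /qsymP tq]].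
- apply/asboolP; split.
    by exists 0%N => m; rewrite lt0n mdeg_eq0 => /negPf m1; rewrite /GRing.one /= /series_one m1.
  apply/qsymP => g /incr_inj gI m; rewrite /GRing.one /= /series_one.
  by rewrite -{1}(relabel1 g) (inj_eq (relabel_inj gI)).
- split=> [|s t /asboolP[[d sd] sq] /asboolP[[e te] tq]]; apply/asboolP; split.
  + by exists 0%N.
  + by [].
  + exists (d + e)%N => m mde.
    have -> : (s + t) m = s m + t m by [].
    by rewrite sd ?te ?addr0 //; apply: leq_trans mde; rewrite ltnS (leq_addr, leq_addl).
  + move=> g gI a; have sD m : (s + t) m = s m + t m by [].
    by rewrite !sD (sq g) // (tq g).
- move=> a s /asboolP[[d sd] sq]; have sZ m : (a *: s) m = a * s m by [].
  apply/asboolP; split; first by exists d => m /sd; rewrite sZ => ->; rewrite mulr0.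
  by move=> g gI b; rewrite !sZ (sq g).
- apply/asboolP; split.
    exists (d + e)%N => m mde; apply: fsbig1 => -[a b] /= abm.
    have : (d < mdeg a)%N || (e < mdeg b)%N.
      rewrite -[_ || _]negbK negb_or -!leqNgt; apply/negP => /andP[ad be].
      by move: mde; rewrite -abm mdegM ltnNge leq_add.
    by case/orP => [/sd|/te] ->; rewrite ?mul0r ?mulr0.
  apply/qsymP => g gI m; have gJ := incr_inj gI.
  rewrite [LHS](@reindex_fsbig _ _ _ _ _ (fun p => (relabel g p.1, relabel g p.2))
    [set p : {cmonom posn} * {cmonom posn} | mmul p.1 p.2 = m]%classic).
    by apply: eq_fsbigr => p _; rewrite sq // tq.
  split=> [[a b] /= <-|[a b] [c d'] _ _ [/(relabel_inj gJ) -> /(relabel_inj gJ) ->]|[a b] /= abm] //.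
    by rewrite relabelM.
  by have [c -> [d' -> cd]] := relabel_surj gJ abm; exists (c, d').
Qed.
HB.instance Definition _ := GRing.isSubalgClosed.Build K series is_qsym is_qsym_subalg.

Record qsym := QSym { qsval :> series; qsvalP : qsval \in is_qsym }.
HB.instance Definition _ := [isSub for qsval].
HB.instance Definition _ := [Choice of qsym by <:].
HB.instance Definition _ := [SubChoice_isSubAlgebra of qsym by <:].
HB.instance Definition _ := [SubNzRing_isSubComNzRing of qsym by <:].

End Series.
Record composition :=
  Composition { cparts :> seq nat; cpartsP : all (fun n => (0 < n)%N) cparts }.
HB.instance Definition _ := [isSub for cparts].
HB.instance Definition _ := [Countable of composition by <:].

Fact take_composition_subproof (k : nat) (a : composition) :
  all (fun n => (0 < n)%N) (take k a).
Proof. by case: a => a /= aP; rewrite -(cat_take_drop k a) all_cat in aP; case/andP: aP. Qed.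
Definition take_composition k a := Composition (take_composition_subproof k a).

Fact drop_composition_subproof (k : nat) (a : composition) :
  all (fun n => (0 < n)%N) (drop k a).
Proof. by case: a => a /= aP; rewrite -(cat_take_drop k a) all_cat in aP; case/andP: aP. Qed.
Definition drop_composition k a := Composition (drop_composition_subproof k a).

Lemma finite_sumn_le (d : nat) :
  finite_set [set a : composition | (sumn a <= d)%N]%classic.
Proof.
pose F (h : {ffun 'I_d -> 'I_d.+1}) : composition :=
  Composition (filter_all (fun n => (0 < n)%N) [seq (h i : nat) | i <- enum 'I_d]).
apply: (@sub_finite_set _ _ (F @` [set: _])%classic); last first.
  exact/finite_image/finite_finset.
move=> [a aP] /= ad.
have nthd k : (nth 0%N a k <= d)%N.
  apply: leq_trans ad; case: (ltnP k (size a)) => ka; last by rewrite nth_default.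
  by rewrite sumnE (big_nth 0%N) (big_rem k) ?mem_index_iota //= leq_addr.
have sad : (size a <= d)%N.
  apply: leq_trans ad; elim: a aP {nthd} => //= n a IH /andP[n0 /IH].
  by move=> h; rewrite -add1n leq_add.
exists [ffun i : 'I_d => inord (nth 0%N a i)] => //; apply: val_inj => /=.
have -> : [seq ([ffun i : 'I_d => inord (nth 0%N a i) : 'I_d.+1] i : nat) | i <- enum 'I_d]
    = a ++ nseq (d - size a) 0%N.
  transitivity (mkseq (nth 0%N a) d).
    rewrite /mkseq -val_enum_ord -map_comp; apply: eq_map => i /=.
    by rewrite ffunE inordK // ltnS.
  apply: (@eq_from_nth _ 0%N) => [|k]; rewrite size_mkseq.
    by rewrite size_cat size_nseq subnKC.
  move=> kd; rewrite nth_mkseq // nth_cat; case: ltnP => // ka.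
  by rewrite nth_nseq nth_default // if_same.
rewrite filter_cat (all_filterP aP) -[RHS]cats0; congr (_ ++ _).
by elim: (d - size a)%N.
Qed.

Section QSym.
Variable K : fieldType.

Definition index_lt (i j : posn) : bool := (i < j)%N.

(* The sum over i_1 < ... < i_n of x_(i_1)^a_1 ... x_(i_n)^a_n. *)
Definition Mseries (a : seq nat) : series K :=
  series_sum [set i : (size a).-tuple posn | sorted index_lt i]%classic
    (fun i => \prod_(k < size a) svar K (tnth i k) ^+ nth 0%N a k).

Let tmonom (a : seq nat) (i : (size a).-tuple posn) : {cmonom posn} :=
  \big[mmul/mone]_(k < size a) expcmn (ucm (tnth i k)) (nth 0%N a k).

Let MseriesE a m : Mseries a m =
  \sum_(i \in [set i : (size a).-tuple posn | sorted index_lt i]%classic)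
    ((m == tmonom i)%:R : K).
Proof.
apply: eq_fsbigr => i _.
under eq_bigr => k _ do rewrite /svar smonomX.
by rewrite smonom_prod.
Qed.

Let tmonom_imonom a (i : (size a).-tuple posn) p0 :
  tmonom i = imonom (fun k => nth p0 i k) a.
Proof. by apply: eq_bigr => k _; rewrite (tnth_nth p0). Qed.

Let tmonom_deg a (i : (size a).-tuple posn) : mdeg (tmonom i) = sumn a.
Proof. by rewrite (tmonom_imonom i (posnS 0)) mdeg_imonom. Qed.

Let relabel_tmonom a (i : (size a).-tuple posn) g :
  relabel g (tmonom i) = tmonom (map_tuple g i).
Proof.
rewrite (tmonom_imonom i (posnS 0)) relabel_imonom.
rewrite (tmonom_imonom _ (posnS 0)); apply: eq_bigr => k _ /=.
by rewrite (nth_map (posnS 0)) ?size_tuple.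
Qed.

Let tmonom_gt0 a (i : (size a).-tuple posn) p : all (fun n => (0 < n)%N) a ->
  (0 < tmonom i p)%N = (p \in tval i).
Proof.
move=> aP; rewrite (tmonom_imonom i (posnS 0)) imonomE lt0n sum_nat_eq0.
apply/idP/idP => [/forallPn[k]|/(nthP (posnS 0))[k]].
  by rewrite muln_eq0 negb_or => /andP[_]; rewrite eqb0 negbK => /eqP <-; rewrite mem_nth ?size_tuple.
rewrite size_tuple => ka kp; apply/forallPn; exists (Ordinal ka) => /=.
rewrite kp eqxx muln1 -lt0n; exact: (allP aP) (mem_nth _ _).
Qed.

Fact Mseries_qsym (a : composition) : Mseries a \in @is_qsym K.
Proof.
case: a => a /= aP; apply/asboolP; split.
  exists (sumn a) => m ma; rewrite MseriesE; apply: fsbig1 => i _.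
  by case: eqP ma => // ->; rewrite tmonom_deg ltnn.
apply/qsymP => g gI m; have gJ := incr_inj gI.
have mono : {mono g : p q / index_lt p q}.
  move=> p q; rewrite /index_lt; case: (ltngtP p q) => [/gI //|/gI|].
    by move/ltnW; rewrite leqNgt => /negPf.
  by move/val_inj ->; rewrite ltnn.
have smap s : sorted index_lt (map g s) = sorted index_lt s.
  by rewrite sorted_map; apply: eq_sorted => p q; rewrite /= mono.
pose Inc := [set i : (size a).-tuple posn | sorted index_lt i]%classic.
have E n : Mseries a n = \sum_(i \in (Inc `&` [set i | tmonom i = n])%classic) (1 : K).
  rewrite MseriesE fsbig_mkcondr; apply: eq_fsbigr => i _.
  rewrite /patch; case: eqP => [->|/eqP ni]; first by rewrite mem_set.
  by rewrite memNset // => in_; rewrite in_ eqxx in ni.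
rewrite !E (@reindex_fsbig _ _ _ _ _ (map_tuple g) (Inc `&` [set i | tmonom i = m])%classic) //.
split=> [i [si im]|i j _ _ ij|i [si im]].
- split; last by rewrite /= -relabel_tmonom im.
  by rewrite /Inc /= smap.
- apply/val_inj/(inj_map gJ); exact: (congr1 val ij).
- have ig p : p \in tval i -> exists q, p = g q.
    rewrite -tmonom_gt0 // im; have [[q <-]|np] := pselect (exists q, g q = p).
      by exists q.
    by rewrite relabelN // => q; apply/eqP=> gq; apply: np; exists q.
  pose j := [tuple xget (posnS 0) [set q | tnth i k = g q]%classic | k < size a].
  have ji : map_tuple g j = i.
    apply: eq_from_tnth => k; rewrite tnth_map tnth_mktuple.
    by case: xgetP => [q _ /= <-//|/(_ _) nq]; have [q /nq] := ig _ (mem_tnth k i).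
  exists j => //; split; last by apply: (relabel_inj gJ); rewrite relabel_tmonom ji.
  by move: si; rewrite /Inc /= -{1}ji /= smap.
Qed.

Definition qsM (a : composition) : qsym K := QSym (Mseries_qsym a).

Definition qcoef (g : qsym K) (m : {cmonom posn}) : K := qsval g m.

Let index_lt_irr : irreflexive index_lt. Proof. by move=> p; rewrite /index_lt ltnn. Qed.
Let index_lt_trans : transitive index_lt. Proof. by move=> p q r; exact: ltn_trans. Qed.

Let std_index (a : seq nat) : (size a).-tuple posn := [tuple posnS k | k < size a].

Let std_indexE (a : seq nat) : tval (std_index a) = [seq posnS k | k <- iota 0 (size a)].
Proof. by rewrite /= -val_enum_ord -map_comp. Qed.

Let std_index_sorted a : sorted index_lt (std_index a).
Proof. by rewrite std_indexE sorted_map; exact: iota_ltn_sorted. Qed.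

Let tmonom_std a : tmonom (std_index a) = imonom posnS a.
Proof. by apply: eq_bigr => k _; rewrite tnth_mktuple. Qed.

Let tmonom_inj (a b : seq nat) (i : (size a).-tuple posn) :
  all (fun n => (0 < n)%N) a -> all (fun n => (0 < n)%N) b ->
  sorted index_lt i -> tmonom i = imonom posnS b -> a = b /\ i = std_index a.
Proof.
move=> aP bP si ib.
have E : tval i = tval (std_index b).
  apply: (irr_sorted_eq index_lt_trans index_lt_irr si (std_index_sorted b)) => p.
  by rewrite -!tmonom_gt0 // ib tmonom_std.
have sab : size a = size b by rewrite -(size_tuple i) E size_tuple.
have iE : i = std_index a by apply: val_inj; rewrite /= E !std_indexE sab.
split=> //; apply: (@eq_from_nth _ 0%N) => // k ka.
have coef c : (k < size c)%N -> imonom posnS c (posnS k) = nth 0%N c k.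
  move=> kc; rewrite imonomE (bigD1 (Ordinal kc)) //= eqxx muln1 big1 ?addn0 // => l lk.
  rewrite (_ : (posnS l == posnS k) = false) ?muln0 //.
  by apply/eqP=> -[lkE]; case/eqP: lk; apply: val_inj.
by rewrite -coef // -[RHS]coef -?sab // -ib iE tmonom_std.
Qed.

Lemma qcoef_qsM (a b : composition) : qcoef (qsM a) (imonom posnS b) = (a == b)%:R.
Proof.
rewrite /qcoef /= MseriesE.
have [<-|ab] := eqVneq a b; last first.
  apply: fsbig1 => i si; case: eqP => // /esym ib.
  have [/val_inj abE _] := tmonom_inj (cpartsP a) (cpartsP b) si ib.
  by rewrite abE eqxx in ab.
rewrite -(fsbig_widen [set std_index a]%classic).
- by rewrite fsbig_set1 tmonom_std eqxx.
- by move=> _ ->; exact: std_index_sorted.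
- move=> i [si /= ni]; case: eqP => // /esym ib; case: ni.
  by have [] := tmonom_inj (cpartsP a) (cpartsP a) si ib.
Qed.

Definition qs_coprod_basis (a : composition) : tensor (qsym K) (qsym K) :=
  \sum_(k < (size a).+1) qsM (take_composition k a) ⊗ qsM (drop_composition k a).

(* The coordinate of g on qsM a is its coefficient at x_1^a_1 ... x_n^a_n
   (qcoef_qsM), so this extends deconcatenation linearly (qs_coprod_qsM). *)
Definition qs_coprod (g : qsym K) : tensor (qsym K) (qsym K) :=
  \sum_(a \in [set: composition]%classic)
    qcoef g (imonom posnS a) *: qs_coprod_basis a.

(* The counit is 1 on qsM of the empty composition and 0 on the other qsM a:
   it is the constant term. *)
Definition qs_counit (g : qsym K) : K := qcoef g mone.

Lemma qs_coprodE (d : nat) (g : qsym K) :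
  (forall m, (d < mdeg m)%N -> qcoef g m = 0) ->
  qs_coprod g = \sum_(a <- fset_set [set a : composition | (sumn a <= d)%N]%classic)
    qcoef g (imonom posnS a) *: qs_coprod_basis a.
Proof.
move=> gd; rewrite -fsbig_finite; last exact: finite_sumn_le.
symmetry; apply: fsbig_widen => // a [_ /= /negP]; rewrite -ltnNge => ad.
by rewrite /= gd ?scale0r // mdeg_imonom.
Qed.

Lemma qs_bounded (g : qsym K) : exists d, forall m, (d < mdeg m)%N -> qcoef g m = 0.
Proof. by have /asboolP[] := qsvalP g. Qed.

Fact qs_coprod_linear : linear qs_coprod.
Proof.
move=> c g h; have [d gd] := qs_bounded g; have [e he] := qs_bounded h.
have cD m : qcoef (c *: g + h) m = c * qcoef g m + qcoef h m by [].
have le1 m : (d + e < mdeg m)%N -> (d < mdeg m)%N by exact/leq_ltn_trans/leq_addr.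
have le2 m : (d + e < mdeg m)%N -> (e < mdeg m)%N by exact/leq_ltn_trans/leq_addl.
rewrite (@qs_coprodE (d + e) (_ + h)) => [|m mde]; last first.
  by rewrite cD gd ?he ?mulr0 ?addr0 //; [exact: le2|exact: le1].
rewrite (@qs_coprodE (d + e) g) => [|m /le1/gd //].
rewrite (@qs_coprodE (d + e) h) => [|m /le2/he //].
rewrite scaler_sumr -big_split; apply: eq_bigr => a _.
by rewrite cD scalerDl -scalerA.
Qed.
HB.instance Definition _ :=
  GRing.isLinear.Build K (qsym K) (tensor (qsym K) (qsym K)) _ qs_coprod qs_coprod_linear.

Lemma qs_coprod_qsM (a : composition) : qs_coprod (qsM a) = qs_coprod_basis a.
Proof.
rewrite /qs_coprod -(fsbig_widen [set a]%classic) //.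
  by rewrite fsbig_set1 qcoef_qsM eqxx scale1r.
move=> b [_ nba]; change (qcoef (qsM a) (imonom posnS b) *: qs_coprod_basis b = 0).
rewrite qcoef_qsM; case: eqP => [ab|_]; last by rewrite scale0r.
by case: nba.
Qed.

End QSym.

Section LinearExtensions.
Variables (E : finType) (T : topology E).

Definition top_le (i j : E) : bool := [forall O in opens T, (i \in O) ==> (j \in O)].
Definition top_equiv (i j : E) : bool := top_le i j && top_le j i.

Definition top_lt (i j : E) : bool := top_le i j && ~~ top_equiv i j.

Definition Lin : set {ffun E -> posn} :=
  [set f : {ffun E -> posn} | forall i j, top_le i j -> (f i <= f j)%N]%classic.

Definition std_ext (f : {ffun E -> posn}) : Prop :=
  exists k : nat, forall n : posn, (exists i, f i = n) <-> (n <= k)%N.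

Definition LinStd : set {ffun E -> posn} := (Lin `&` [set f | std_ext f])%classic.

Definition alpha (f : {ffun E -> posn}) : nat :=
  #|[set p : E * E | top_lt p.1 p.2 && (f p.1 == f p.2)]|.

End LinearExtensions.

(* The elements i_1 < ... < i_k of f(E). *)
Definition image_values (E : finType) (f : {ffun E -> posn}) : seq posn :=
  sort (fun i j : posn => (i <= j)%N) (undup (codom f)).

Fact packing_subproof (E : finType) (f : {ffun E -> posn}) :
  all (fun n => (0 < n)%N) [seq #|[set x | f x == v]| | v <- image_values f].
Proof.
apply/allP=> _ /mapP[v + ->]; rewrite mem_sort mem_undup => /codomP[x ->].
by rewrite card_gt0; apply/set0Pn; exists x; rewrite !inE.
Qed.

Definition packing (E : finType) (f : {ffun E -> posn}) : composition :=
  Composition (packing_subproof f).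

(* Main.v *)
Require Import Defs.
From HB Require Import structures.
From mathcomp Require Import all_boot all_algebra finmap.
From mathcomp Require Import boolp classical_sets functions cardinality fsbigop.
From mathcomp.multinomials Require Import monalg.

Set Implicit Arguments.
Unset Strict Implicit.
Unset Printing Implicit Defensive.

Import GRing.Theory.
Local Open Scope ring_scope.

(* A quasisymmetric function is determined by its coefficients at the monomials
   x_1^a_1 ... x_n^a_n. For phi_q(T) this coefficient is a finite sum over the
   monotone maps f : E -> {1, ..., n} with fibers of sizes a_1, ..., a_n; if all
   a_k are positive these f are the standard linear extensions with P(f) = a,
   which is the expansion in the basis M.
   - Product: monotone maps on a disjoint union are pairs of monotone maps.
   - Coproduct: a monotone map to {1, ..., m + n} is an open set O (the preimage
     of the last n levels) with monotone maps on E \ O and on O, and elements of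
     different parts never share a level, so alpha is additive.
   - Antipode: phi S_F and S_QSym phi are left convolution inverses of phi. Such
     an inverse is determined by induction on |E|, the term O = empty set of the
     convolution isolating its value at T.
   - Surjectivity: the chain of blocks of sizes a_1, ..., a_n is sent to M_a plus
     a combination of M_b with b shorter than a. *)

(** * Finite spaces as preorders *)

Section Specialization.
Variables (E : finType) (T : topology E).

Lemma top_leP (i j : E) :
  reflect (forall O, O \in opens T -> i \in O -> j \in O) (top_le T i j).
Proof.
apply: (iffP forall_inP) => h O OT; first by move/implyP: (h O OT).
by apply/implyP; exact: h.
Qed.

(** By finiteness the intersection [U i] of all open sets containing [i] is open; an up-closed set
    is the union of the [U i] over its points. This lets the rest of the proof speak of the preorder
    only. *)
Lemma open_upP (O : {set E}) :
  reflect (forall i j, i \in O -> top_le T i j -> j \in O) (O \in opens T).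
Proof.
apply: (iffP idP) => [OT i j iO /top_leP/(_ O OT)/(_ iO) //|up].
pose U i : {set E} := \bigcap_(A in opens T | i \in A) A.
have UT i : U i \in opens T.
  apply: (big_ind (fun A => A \in opens T)) => [||A /andP[]//].
    exact: openT.
  exact: openI.
have -> : O = finset.cover [set U i | i in O].
  apply/setP=> x; rewrite cover_imset; apply/idP/bigcupP => [xO|[i iO /bigcapP xU]].
    by exists x => //; apply/bigcapP=> A /andP[].
  by apply: (up i) => //; apply/top_leP=> A AT iA; apply: xU; rewrite AT.
by apply: open_cover; apply/fintype.subsetP=> _ /imsetP[i _ ->].
Qed.

End Specialization.

Lemma top_le_pullback (E E' : finType) (f : E' -> E) (T : topology E) x y :
  top_le (pullback f T) x y = top_le T (f x) (f y).
Proof.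
apply/top_leP/top_leP => h O.
  by move=> OT fx; have := h (f @^-1: O); rewrite !inE; apply=> //; exact: imset_f.
by move=> /imsetP[A AT ->]; rewrite !inE; exact: h.
Qed.

Lemma top_le_homeo (E E' : finType) (T : topology E) (T' : topology E') (f : E -> E') :
  bijective f -> (forall O : {set E'}, (f @^-1: O \in opens T) = (O \in opens T')) ->
  forall x y, top_le T' (f x) (f y) = top_le T x y.
Proof.
move=> [g fK gK] fT x y; rewrite -top_le_pullback; congr (top_le _ x y).
apply: topologyP => O; apply/imsetP/idP => [[A AT ->]|OT]; first by rewrite fT.
have OE : O = f @^-1: (g @^-1: O) by apply/setP=> z; rewrite !inE fK.
by exists (g @^-1: O); rewrite // -fT -OE.
Qed.

Section SumTopology.
Variables (E E' : finType) (T : topology E) (T' : topology E').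
Local Notation S := (sum_topology T T').

Let cyl (A : {set E}) (B : {set E'}) : {set E + E'} :=
  [set x | match x with inl a => a \in A | inr b => b \in B end].

Let cyl_open A B : A \in opens T -> B \in opens T' -> cyl A B \in opens S.
Proof.
have lA : inl @^-1: cyl A B = A by apply/setP=> x; rewrite !inE.
have rB : inr @^-1: cyl A B = B by apply/setP=> x; rewrite !inE.
by move=> AT BT; rewrite inE lA rB AT.
Qed.

Lemma top_le_sum (x y : E + E') :
  top_le S x y = match x, y with
    | inl a, inl b => top_le T a b | inr a, inr b => top_le T' a b | _, _ => false end.
Proof.
case: x => a; case: y => b; apply/idP/idP => //.
- move=> /top_leP h; apply/top_leP=> O OT aO.
  by have := h _ (cyl_open OT (open0 T')); rewrite !inE; apply.
- move=> /top_leP h; apply/top_leP=> O; rewrite inE => /andP[OT _] aO.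
  by have := h _ OT; rewrite !inE; apply.
(* The left summand is itself an open set, which contains [a] and misses [b]; the mirror case uses
   the right summand. *)
- by apply/negP=> /top_leP/(_ _ (cyl_open (openT T) (open0 T'))) /=; rewrite !inE => /(_ isT).
- by apply/negP=> /top_leP/(_ _ (cyl_open (open0 T) (openT T'))) /=; rewrite !inE => /(_ isT).
- move=> /top_leP h; apply/top_leP=> O OT aO.
  by have := h _ (cyl_open (open0 T) OT); rewrite !inE; apply.
- move=> /top_leP h; apply/top_leP=> O; rewrite inE => /andP[_ OT] aO.
  by have := h _ OT; rewrite !inE; apply.
Qed.

End SumTopology.

(* The chain of the level sets of l, each of them an indiscrete block. *)
Section LevelTopology.
Variables (E : finType) (l : E -> nat).

Fact level_topology_subproof :
  is_topology [set O : {set E} | [forall x in O, forall y, (l x <= l y)%N ==> (y \in O)]].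
Proof.
have upP (O : {set E}) : reflect (forall x y, x \in O -> (l x <= l y)%N -> y \in O)
    [forall x in O, forall y, (l x <= l y)%N ==> (y \in O)].
  apply: (iffP forall_inP) => [h x y /h/forallP/(_ y)/implyP //|h x xO].
  by apply/forallP=> y; apply/implyP; exact: h.
apply: is_topologyP; split=> [||A B|C /fintype.subsetP CT]; rewrite ?inE.
- by apply/upP=> x y; rewrite inE.
- by apply/upP=> x y; rewrite !inE.
- move=> /upP hA /upP hB; apply/upP=> x y; rewrite !inE => /andP[xA xB] xy.
  by rewrite (hA x) // (hB x).
- apply/upP=> x y /bigcupP[A AC xA] xy; apply/bigcupP; exists A => //.
  by move/CT: AC; rewrite inE => /upP/(_ x y xA xy).
Qed.

Definition level_topology : topology E := Topology level_topology_subproof.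

Lemma top_le_level x y : top_le level_topology x y = (l x <= l y)%N.
Proof.
apply/top_leP/idP => [|xy O].
  move/(_ [set z | (l x <= l z)%N]); rewrite !inE; apply=> //.
  apply/forall_inP=> z; rewrite inE => xz; apply/forallP=> t; rewrite inE.
  by apply/implyP; exact: leq_trans.
by rewrite inE => /forall_inP h /h/forallP/(_ y)/implyP; apply.
Qed.

End LevelTopology.

(** * Monotone maps, ties and fibers *)

Section Levels.
Variables (E : finType) (T : topology E).

(** These three notions take maps to [nat], so that values in [posn], levels in ['I_n] and
    restrictions to subspaces are treated alike. Ties and fibers are sums of booleans, which split
    along disjoint unions and reindex along bijections. *)
Definition monotone (f : E -> nat) : bool :=
  [forall i, forall j, top_le T i j ==> (f i <= f j)%N].

Definition ties (f : E -> nat) : nat :=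
  (\sum_i \sum_j (top_lt T i j && (f i == f j)))%N.

Definition fiber (f : E -> nat) (k : nat) : nat := (\sum_i (f i == k))%N.

Lemma monotoneP (f : E -> nat) :
  reflect (forall i j, top_le T i j -> (f i <= f j)%N) (monotone f).
Proof.
apply: (iffP forallP) => [h i j|h i]; first by move/forallP/(_ j)/implyP: (h i).
by apply/forallP=> j; apply/implyP; exact: h.
Qed.

Lemma top_ltE i j : top_lt T i j = top_le T i j && ~~ top_le T j i.
Proof. by rewrite /top_lt /top_equiv; case: (top_le T i j). Qed.

Lemma LinP (f : {ffun E -> posn}) : Lin T f <-> monotone (fun i => f i).
Proof. by split=> [h|/monotoneP h]; [apply/monotoneP|]. Qed.

Lemma alphaE (f : {ffun E -> posn}) : alpha T f = ties (fun i => f i).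
Proof.
rewrite /alpha /ties pair_big /= -sum1_card big_mkcond /=.
by apply: eq_bigr => p _; rewrite inE; case: ifP.
Qed.

Lemma fiberE (f : E -> nat) k : fiber f k = #|[pred i | f i == k]|.
Proof. by rewrite /fiber -sum1_card [RHS]big_mkcond; apply: eq_bigr => i _; rewrite inE; case: ifP. Qed.

End Levels.

Section LevelsHomeo.
Variables (E E' : finType) (T : topology E) (T' : topology E') (h : E -> E').
Hypothesis h_bij : bijective h.
Hypothesis hT : forall x y, top_le T' (h x) (h y) = top_le T x y.

Lemma monotone_homeo f : monotone T (f \o h) = monotone T' f.
Proof.
have [g hK gK] := h_bij; apply/monotoneP/monotoneP=> m i j.
  by rewrite -(gK i) -(gK j) hT; exact: m.
by rewrite -hT; exact: m.
Qed.

Lemma ties_homeo f : ties T (f \o h) = ties T' f.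
Proof.
rewrite /ties [RHS](reindex h) /=; last exact: onW_bij.
apply: eq_bigr => i _; rewrite [RHS](reindex h) /=; last exact: onW_bij.
by apply: eq_bigr => j _; rewrite !top_ltE !hT.
Qed.

Lemma fiber_homeo (f : E' -> nat) k : fiber (f \o h) k = fiber f k.
Proof. by rewrite /fiber [RHS](reindex h) //; exact: onW_bij. Qed.

End LevelsHomeo.

(** * The series of linear extensions *)

Lemma series_sumE (K : fieldType) (J : Type) (r : seq J) (P : pred J) (F : J -> series K) m :
  (\sum_(j <- r | P j) F j) m = \sum_(j <- r | P j) F j m.
Proof. exact: (big_morph (fun s : series K => s m)). Qed.

Lemma series_mul_local (K : fieldType) (s s' t t' : series K) m :
  (forall a b, mmul a b = m -> s a = s' a /\ t b = t' b) -> (s * t) m = (s' * t') m.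
Proof. by move=> h; apply: eq_fsbigr => p /set_mem /= /h[-> ->]. Qed.

Section LinearExtensionSeries.
Variables (K : fieldType) (q : K).

Definition value_monom (E : finType) (f : {ffun E -> posn}) : {cmonom posn} :=
  \big[mmul/mone]_i ucm (f i).

Lemma value_monomE (E : finType) (f : {ffun E -> posn}) (p : posn) :
  value_monom f p = fiber (fun i => f i) p.
Proof. by rewrite big_cmE; apply: eq_bigr => i _; rewrite ucmE. Qed.

Lemma mdeg_value_monom (E : finType) (f : {ffun E -> posn}) : mdeg (value_monom f) = #|E|.
Proof. by rewrite mdeg_prod -sum1_card; apply: eq_bigr => i _; rewrite mdegU. Qed.

Definition lin_series (E : finType) (T : topology E) : series K :=
  series_sum (Lin T) (fun f => q ^+ alpha T f *: \prod_(i : E) svar K (f i)).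

Lemma lin_seriesE (E : finType) (T : topology E) m :
  lin_series T m = \sum_(f \in Lin T) q ^+ alpha T f * (m == value_monom f)%:R.
Proof. by apply: eq_fsbigr => f _; rewrite smonom_prod. Qed.

(* The levels of 'I_n count from 0: level k stands for the variable x_(k+1). *)
Definition level_coef (E : finType) (T : topology E) (a : seq nat) : K :=
  \sum_(f : {ffun E -> 'I_(size a)} | monotone T (fun i => f i) &&
      [forall k : 'I_(size a), fiber (fun i => f i) k == nth 0%N a k])
    q ^+ ties T (fun i => f i).

(* phi_q(T) with x_i = 0 for i > N; unlike series_sum, a finite sum. *)
Definition trunc_series (E : finType) (T : topology E) (N : nat) : series K :=
  \sum_(f : {ffun E -> 'I_N} | monotone T (fun i => f i))
    q ^+ ties T (fun i => f i) *: smonom K (value_monom [ffun i => posnS (f i)]).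

(** A linear extension whose monomial is [m] takes its values among the variables of [m], hence in
    1, ..., N. It therefore comes from a map to ['I_N], and all other extensions contribute 0 at
    [m]. *)
Lemma lin_series_trunc (E : finType) (T : topology E) N (m : {cmonom posn}) :
  (forall p : posn, (N < p)%N -> m p = 0%N) -> lin_series T m = trunc_series T N m.
Proof.
move=> mN; rewrite lin_seriesE /trunc_series series_sumE.
pose h (f : {ffun E -> 'I_N}) : {ffun E -> posn} := [ffun i => posnS (f i)].
pose D : {pred {ffun E -> 'I_N}} := fun f => monotone T (fun i => f i).
have hE f : (fun i => h f i : nat) = (fun i => (f i).+1).
  by apply/funext => i; rewrite ffunE.
have hmon f : monotone T (fun i => h f i) = monotone T (fun i => f i).
  by rewrite hE; apply: eq_forallb => i; apply: eq_forallb.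
have hties f : ties T (fun i => h f i) = ties T (fun i => f i).
  by rewrite hE; apply: eq_bigr => i _; apply: eq_bigr.
have hinj : injective h.
  by move=> f g /ffunP fg; apply/ffunP=> i; have := fg i; rewrite !ffunE => -[/val_inj].
(* The finite sum becomes a sum over a set, to be transported along the injection [h] into the sum
   over [Lin T]. *)
rewrite [RHS](@bigfs _ _ _ _ _ D) ?index_enum_uniq //; last first.
  by move=> f _; rewrite mem_index_enum.
rewrite -(@fsbig_widen _ _ _ _ (h @` [set` D])%classic).
- rewrite fsbig_image; last by move=> f g _ _; exact: hinj.
  by apply: eq_fsbigr => f _; rewrite alphaE hties.
- by move=> _ [f fD <-]; apply/LinP; rewrite hmon; exact: fD.
- move=> f [/LinP fL /= nf]; case: eqP => [mf|]; last by rewrite mulr0.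
  have fN i : ((f i).-1 < N)%N.
    rewrite prednK ?posn_gt0 // leqNgt; apply/negP => /mN/eqP.
    by rewrite mf value_monomE sum_nat_eq0 => /forallP/(_ i); rewrite eqxx.
  have fE : f = h [ffun i => Ordinal (fN i)].
    by apply/ffunP=> i; rewrite !ffunE; apply: val_inj; rewrite /= prednK ?posn_gt0.
  case: nf; exists [ffun i => Ordinal (fN i)] => //.
  by have := hmon [ffun i => Ordinal (fN i)]; rewrite -fE fL.
Qed.

Lemma imonom_eq0 i a p : (forall k, (k < size a)%N -> i k != p) -> imonom i a p = 0%N.
Proof.
by move=> ip; rewrite imonomE big1 // => k _; rewrite (negPf (ip k (ltn_ord k))) muln0.
Qed.

Lemma imonom_posnS a k : imonom posnS a (posnS k) = nth 0%N a k.
Proof.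
case: (ltnP k (size a)) => ka; last first.
  rewrite nth_default // imonom_eq0 // => l la.
  by apply/eqP=> -[lk]; rewrite lk ltnNge ka in la.
rewrite imonomE (bigD1 (Ordinal ka)) //= eqxx muln1 big1 ?addn0 // => l lk.
by rewrite (_ : (posnS l == posnS k) = false) ?muln0 //; apply: contraNF lk => /eqP[lE]; exact/eqP/val_inj.
Qed.

Lemma posnSK (p : posn) : posnS p.-1 = p.
Proof. by apply: val_inj; rewrite /= prednK ?posn_gt0. Qed.

Lemma eq_imonomP (m : {cmonom posn}) a :
  reflect (forall k, m (posnS k) = nth 0%N a k) (m == imonom posnS a).
Proof.
apply: (iffP eqP) => [-> k|h]; first by rewrite imonom_posnS.
by apply/eqP/cmP=> p; rewrite -(posnSK p) imonom_posnS.
Qed.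

(** The monomial involves no variable beyond the one of index [size a], so truncation there is
    exact; comparing exponents then prescribes the fiber of each level. *)
Lemma lin_series_coef (E : finType) (T : topology E) (a : seq nat) :
  lin_series T (imonom posnS a) = level_coef T a.
Proof.
rewrite (@lin_series_trunc _ _ (size a)) => [|p ap]; last first.
  by rewrite imonom_eq0 // => k ka; apply: contraTneq ap => <-; rewrite -leqNgt.
rewrite /trunc_series series_sumE /level_coef big_mkcondr; apply: eq_bigr => f _.
rewrite -[(_ *: _) _]/(_ * (_ == _)%:R) eq_sym.
have fE : (fun i => [ffun i => posnS (f i)] i : nat) = (fun i => (f i).+1).
  by apply/funext => i; rewrite ffunE.
have -> : (value_monom [ffun i => posnS (f i)] == imonom posnS a) =
    [forall k : 'I_(size a), fiber (fun i => f i) k == nth 0%N a k].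
  apply/eq_imonomP/forallP => [h k|h k].
    by rewrite -h value_monomE fE.
  rewrite value_monomE fE; case: (ltnP k (size a)) => ka.
    by rewrite -(eqP (h (Ordinal ka))).
  (* Past the end of [a] the default exponent 0 agrees with the empty fiber, since all levels are
     below [size a]. *)
  rewrite nth_default // /fiber big1 // => i _.
  by case: eqP => // -[fk]; move: ka; rewrite -fk leqNgt ltn_ord.
by case: ifP; rewrite ?mulr1 ?mulr0.
Qed.

End LinearExtensionSeries.

(** * Quasisymmetric functions and their coordinates *)

Lemma increasing_mono g : increasing g -> forall i j, (g i <= g j)%N = (i <= j)%N.
Proof.
move=> gI i j; case: (leqP i j) => [|/gI]; last by rewrite ltnNge => /negPf.
by rewrite leq_eqVlt => /orP[/eqP/val_inj ->|/gI/ltnW]; rewrite ?leqnn.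
Qed.

(** The map [g] enumerates the support of [m] in increasing order and [b] lists the exponents there,
    which are positive. Beyond the support [g] has to be continued increasingly. *)
Lemma monom_composition (m : {cmonom posn}) :
  exists2 g, increasing g & exists b : composition, m = relabel g (imonom posnS b).
Proof.
pose leP := fun i j : posn => (i <= j)%N.
pose s := sort leP (finsupp m).
have ss : sorted leP s by apply: sort_sorted => i j; exact: leq_total.
have us : uniq s by rewrite sort_uniq fset_uniq.
have ltP : sorted (fun i j : posn => (i < j)%N) s.
  have sp : sorted leq (map posn_val s) by rewrite sorted_map.
  have : sorted ltn (map posn_val s).
    by rewrite ltn_sorted_uniq_leq sp andbT map_inj_uniq //; exact: val_inj.
  by rewrite sorted_map.
pose M := (\max_(i <- finsupp m) i)%N.
(* The default value p + M + 1 exceeds the whole support and grows with [p], which keeps [g]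
   strictly increasing past the end of [s]. *)
pose g (p : posn) := nth (posnS (p + M)) s p.-1.
have gM (i : posn) : (i.-1 < size s)%N -> (g i <= M)%N.
  move=> /(mem_nth (posnS (i + M))); rewrite mem_sort => gs.
  exact: (@leq_bigmax_seq _ _ _ (fun i : posn => i : nat)).
exists g => [i j ij|].
  have ij' : (i.-1 < j.-1)%N by rewrite -ltnS !prednK ?posn_gt0.
  case: (ltnP j.-1 (size s)) => js.
    have is_ := ltn_trans ij' js.
    rewrite /g (set_nth_default (posnS (i + M)) _ js).
    by apply: (sorted_ltn_nth _ (posnS (i + M)) ltP) => // j' i' k'; exact: ltn_trans.
  rewrite [g j]/g nth_default //=; case: (ltnP i.-1 (size s)) => is_.
    by rewrite ltnS (leq_trans (gM _ is_)) // leq_addl.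
  by rewrite /g nth_default //= ltnS ltn_add2r.
have bP : all (fun n => 0 < n)%N [seq m p | p <- s].
  apply/allP=> _ /mapP[p ps ->]; move: ps; rewrite mem_sort lt0n.
  by rewrite mem_finsupp.
exists (Composition bP); rewrite relabel_imonom; apply/eqP/cmP=> p.
have gE k : (k < size s)%N -> g (posnS k) = nth p s k.
  by move=> ks; rewrite /g (set_nth_default p).
rewrite imonomE /= size_map; case: (boolP (p \in s)) => ps; last first.
  rewrite big1 => [|k _].
    by apply: fsfun_dflt; rewrite mem_sort in ps.
  rewrite gE //; case: eqP => [kp|]; rewrite ?muln0 //.
  by case/negP: ps; rewrite -kp mem_nth.
have ks : (index p s < size s)%N by rewrite index_mem.
rewrite (bigD1 (Ordinal ks)) //= gE // nth_index // eqxx muln1 (nth_map p) //.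
rewrite nth_index // big1 ?addn0 // => k kp; rewrite gE //.
case: eqP => [kE|]; rewrite ?muln0 //.
by case/eqP: kp; apply: val_inj; rewrite /= -kE index_uniq.
Qed.

(** Every monomial is an increasing relabelling of some [imonom posnS b], and quasisymmetric series
    have equal coefficients at the two. *)
Lemma qsym_ext (K : fieldType) (g h : qsym K) :
  (forall b : composition, qcoef g (imonom posnS b) = qcoef h (imonom posnS b)) -> g = h.
Proof.
move=> gh; apply/val_inj/seriesP=> m; have [r rI [b ->]] := monom_composition m.
have /asboolP[_ /qsymP gq] := qsvalP g; have /asboolP[_ /qsymP hq] := qsvalP h.
by rewrite /= gq // hq //; exact: gh.
Qed.

Lemma qcoef_sum (K : fieldType) (J : Type) (r : seq J) (P : pred J) (F : J -> qsym K) m :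
  qcoef (\sum_(j <- r | P j) F j) m = \sum_(j <- r | P j) qcoef (F j) m.
Proof. exact: (big_morph (fun g : qsym K => qcoef g m)). Qed.

(** By [qcoef_qsM] the coefficients at the monomials [imonom posnS a] are coordinates dual to the
    [qsM a]; the degree bound leaves finitely many of them. *)
Lemma qsym_decomp (K : fieldType) (g : qsym K) d :
  (forall m, (d < mdeg m)%N -> qcoef g m = 0) ->
  g = \sum_(a <- fset_set [set a : composition | (sumn a <= d)%N]%classic)
        qcoef g (imonom posnS a) *: qsM K a.
Proof.
move=> gd; apply: qsym_ext => b; rewrite qcoef_sum.
under eq_bigr do rewrite -[qcoef (_ *: _) _]/(_ * qcoef _ _) qcoef_qsM.
case: (boolP (b \in fset_set [set a : composition | (sumn a <= d)%N]%classic)) => bd.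
  rewrite (big_fsetD1 b) //= eqxx mulr1 big1_fset ?addr0 // => a.
  by rewrite !inE => /andP[/negPf -> _]; rewrite mulr0.
rewrite big1_fset ?gd // => [|a ad _]; last first.
  by case: eqP => [ab|]; rewrite ?mulr0 //; rewrite ab (negPf bd) in ad.
rewrite mdeg_imonom ltnNge; apply: contraNN bd => bd.
by rewrite in_fset_set ?mem_set //; exact: finite_sumn_le.
Qed.

(** * Quasisymmetry and invariance under homeomorphism *)

Section LinQSym.
Variables (K : fieldType) (q : K).

Section OneSpace.
Variables (E : finType) (T : topology E).

Lemma lin_series_deg m : (#|E| < mdeg m)%N -> lin_series q T m = 0.
Proof.
move=> mE; rewrite lin_seriesE; apply: fsbig1 => f _.
by case: eqP mE => [->|]; rewrite ?mulr0 // mdeg_value_monom ltnn.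
Qed.

(** For [g] increasing, composition with [g] is a bijection from the extensions with monomial [m] to
    those with monomial [relabel g m]. It preserves [alpha] because [g] is injective. *)
Fact lin_series_qsym : lin_series q T \in @is_qsym K.
Proof.
apply/asboolP; split; first by exists #|E|; exact: lin_series_deg.
apply/qsymP => g gI m; have gJ := incr_inj gI.
have relE f : relabel g (value_monom f) = value_monom [ffun i : E => g (f i)].
  rewrite /value_monom (big_morph _ (relabelM g) (relabel1 g)).
  by apply: eq_bigr => i _; rewrite relabelU ffunE.
pose D (m : {cmonom posn}) := (Lin T `&` [set f | value_monom f = m])%classic.
have coefE n : lin_series q T n = \sum_(f \in D n) q ^+ alpha T f.
  rewrite lin_seriesE fsbig_mkcondr; apply: eq_fsbigr => f _; rewrite eq_sym.
  case: eqP => nf; first by rewrite mem_set ?mulr1.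
  by rewrite memNset ?mulr0.
pose h (f : {ffun E -> posn}) := [ffun i => g (f i)].
rewrite !coefE (@reindex_fsbig _ _ _ _ _ h (D m)).
  apply: eq_fsbigr => f _; congr (_ ^+ _); apply: eq_card => p.
  by rewrite !inE !ffunE (inj_eq gJ).
split=> [f [fL fm]|f f' _ _ /ffunP ff'|f [fL fm]].
- split; last by rewrite /= -relE fm.
  by move=> i j /fL; rewrite !ffunE increasing_mono.
- by apply/ffunP=> i; have := ff' i; rewrite !ffunE => /gJ.
(* Each value of [f] occurs in [relabel g m], whose exponents vanish off the range of [g]; hence [f]
   factors through [g]. *)
- have ig i : exists p, f i = g p.
    have [[p <-]|np] := pselect (exists p, g p = f i); first by exists p.
    have := value_monomE f (f i); rewrite fm relabelN => [/esym/eqP|p]; last first.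
      by apply/eqP=> gp; apply: np; exists p.
    by rewrite sum_nat_eq0 => /forallP/(_ i); rewrite eqxx.
  pose f' := [ffun i => projT1 (cid (ig i))].
  have hf' : h f' = f by apply/ffunP=> i; rewrite !ffunE; case: cid.
  exists f' => //; split; last by apply: (relabel_inj gJ); rewrite relE -[LHS]/(value_monom (h f')) hf'.
  by move=> i j /fL; rewrite -hf' !(ffunE (fun i => g (f' i))) increasing_mono.
Qed.

Definition lin_qsym : qsym K := QSym lin_series_qsym.

Lemma qcoef_lin_qsym a : qcoef lin_qsym (imonom posnS a) = level_coef q T a.
Proof. exact: lin_series_coef. Qed.

Lemma qcoef_lin_qsym0 m : (#|E| < mdeg m)%N -> qcoef lin_qsym m = 0.
Proof. exact: lin_series_deg. Qed.

End OneSpace.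

(** This makes the value depend on the homeomorphism class only: composing with the homeomorphism is
    a bijection on level maps that preserves monotonicity, ties and fibers. *)
Lemma lin_qsym_homeo (E E' : finType) (T : topology E) (T' : topology E') :
  homeomorphic T T' -> lin_qsym T = lin_qsym T'.
Proof.
case=> h hb /(top_le_homeo hb) hT; have [g hK gK] := hb.
apply: qsym_ext => b; rewrite !qcoef_lin_qsym /level_coef.
pose r n (f : {ffun E' -> 'I_n}) : {ffun E -> 'I_n} := [ffun x => f (h x)].
have rb n : bijective (@r n).
  exists (fun f : {ffun E -> 'I_n} => [ffun x => f (g x)]) => f; apply/ffunP=> x;
  by rewrite !ffunE ?hK ?gK.
rewrite (reindex (@r (size b))) /=; last exact: onW_bij.
have rE n f : (fun i => @r n f i : nat) = (fun x => f x : nat) \o h.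
  by apply/funext=> x; rewrite ffunE.
apply: eq_big => [f|f _]; rewrite rE; last by rewrite (ties_homeo hb hT).
rewrite (monotone_homeo hb hT); congr (_ && _).
by apply: eq_forallb => k; rewrite (fiber_homeo hb).
Qed.

End LinQSym.

(** * Standard linear extensions and the basis M *)

Lemma imonom_inj (a b : composition) : imonom posnS a = imonom posnS b -> a = b.
Proof.
(* The Kronecker delta of [qcoef_qsM] separates the monomials; the rationals serve as a field in
   which 1 differs from 0. *)
move=> ab; have := qcoef_qsM rat a b; rewrite -ab qcoef_qsM eqxx.
by case: eqP => // _ /eqP; rewrite oner_eq0.
Qed.

(** For a standard map the sorted list of values is 1, ..., k, so the parts of the packing are the
    exponents of the first k variables, in order. *)
Lemma std_ext_packing (E : finType) (f : {ffun E -> posn}) :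
  std_ext f -> value_monom f = imonom posnS (packing f).
Proof.
case=> k fk.
pose leP := fun i j : posn => (i <= j)%N.
have iE : image_values f = [seq posnS i | i <- iota 0 k].
  apply: (@sorted_eq _ leP).
  - by move=> x y z; exact: leq_trans.
  - by move=> x y; rewrite -eqn_leq => /eqP/val_inj.
  - by apply: sort_sorted => x y; exact: leq_total.
  - by rewrite sorted_map; exact: iota_sorted.
  - apply: uniq_perm.
    + by rewrite sort_uniq undup_uniq.
    + by rewrite map_inj_uniq ?iota_uniq // => x y [].
    + move=> p; rewrite mem_sort mem_undup; apply/codomP/mapP => [[i pE]|[j]].
        have pk : (p <= k)%N by apply/(fk p).1; exists i.
        exists p.-1; last by rewrite posnSK.
        by rewrite mem_iota /= add0n prednK ?posn_gt0.
      rewrite mem_iota /= add0n => jk ->.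
      by have [i <-] := (fk (posnS j)).2 jk; exists i.
apply/eqP/eq_imonomP => j; rewrite value_monomE /= iE -map_comp.
case: (ltnP j k) => jk; last first.
  rewrite nth_default ?size_map ?size_iota // /fiber big1 // => i _.
  case: eqP => // fj; have : (f i <= k)%N by apply/(fk _).1; exists i.
  by rewrite fj /= ltnNge jk.
rewrite (nth_map 0%N) ?size_iota // nth_iota //= add0n fiberE.
by apply: eq_card => i; rewrite !inE.
Qed.

(** As all parts of [b] are positive, a map with this monomial takes exactly the values 1, ...,
    [size b], so it is standard; [imonom_inj] then identifies its packing. *)
Lemma packing_eqP (E : finType) (f : {ffun E -> posn}) (b : composition) :
  value_monom f = imonom posnS b <-> std_ext f /\ packing f = b.
Proof.
split=> [fb|[/std_ext_packing -> -> //]].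
have fS : std_ext f.
  exists (size b) => p; have := congr1 (fun m : {cmonom posn} => m p) fb.
  rewrite value_monomE -{2}(posnSK p) imonom_posnS => fE; split=> [[i fip]|pb].
    rewrite leqNgt; apply/negP; rewrite -{1}(prednK (posn_gt0 p)) ltnS => bp.
    move/eqP: fE; rewrite nth_default // sum_nat_eq0 => /forallP/(_ i).
    by rewrite fip eqxx.
  have : (0 < fiber (fun i => f i) p)%N.
    rewrite fE; apply: (allP (cpartsP b)); apply: mem_nth.
    by rewrite prednK ?posn_gt0.
  rewrite lt0n sum_nat_eq0 => /forallPn[i]; rewrite implyTb eqb0 negbK => /eqP fip.
  by exists i; apply: val_inj.
by split=> //; apply: imonom_inj; rewrite -std_ext_packing.
Qed.

(** Choosing a preimage of each value embeds 1, ..., k into [E], so the values are bounded by the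
    cardinality of [E]. Hence the sum over [LinStd T] is a genuine finite sum. *)
Lemma finite_std_ext (E : finType) : finite_set [set f : {ffun E -> posn} | std_ext f]%classic.
Proof.
pose F (h : {ffun E -> 'I_#|E|}) : {ffun E -> posn} := [ffun i => posnS (h i)].
apply: (@sub_finite_set _ _ (F @` [set: _])%classic); last first.
  exact/finite_image/finite_finset.
move=> f [k fk].
have kE : (k <= #|E|)%N.
  have ch (j : 'I_k) : {i | f i = posnS j} by apply/cid/(fk (posnS j)).2/ltn_ord.
  rewrite -[k]card_ord; apply: (@leq_card _ _ (fun j => projT1 (ch j))) => j j' jj'.
  apply: val_inj; have := projT2 (ch j); rewrite jj' (projT2 (ch j')).
  by case.
have fE i : ((f i).-1 < #|E|)%N.
  rewrite prednK ?posn_gt0 //; apply: leq_trans kE; apply/(fk _).1; by exists i.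
exists [ffun i => Ordinal (fE i)] => //; apply/ffunP=> i; rewrite !ffunE.
exact: posnSK.
Qed.

(** Coefficients are compared at the monomial of a composition [b]: by [packing_eqP] the extensions
    contributing to the left side are the standard ones with packing [b]. *)
Lemma lin_qsym_std (K : fieldType) (q : K) (E : finType) (T : topology E) :
  lin_qsym q T = \sum_(f \in LinStd T) q ^+ alpha T f *: qsM K (packing f).
Proof.
have LF : finite_set (LinStd T) by apply: sub_finite_set (finite_std_ext E) => f [].
apply: qsym_ext => b; rewrite fsbig_finite // qcoef_sum.
rewrite /qcoef [LHS]lin_seriesE.
rewrite -fsbig_finite // -[LHS](@fsbig_widen _ _ _ _ (LinStd T)); last 1 first.
- move=> f [fL nf] /=; case: eqP => [/esym/packing_eqP[fS _]|]; last by rewrite mulr0.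
  by case: nf.
- apply: eq_fsbigr => f /set_mem[_ fS].
  rewrite -[qsval _ _]/(q ^+ alpha T f * qcoef (qsM K (packing f)) (imonom posnS b)).
  rewrite qcoef_qsM; congr (_ * (nat_of_bool _)%:R).
  by apply/idP/idP => /eqP => [/esym/packing_eqP[_ ->]|pb]; apply/eqP => //; apply/esym/packing_eqP.
- by move=> f [].
Qed.

(** * Disjoint unions and products *)

Section SumLevels.
Variables (E E' : finType) (T : topology E) (T' : topology E') (h : E + E' -> nat).

Lemma monotone_sum : monotone (sum_topology T T') h =
  monotone T (h \o inl) && monotone T' (h \o inr).
Proof.
apply/monotoneP/andP => [m|[/monotoneP m /monotoneP m']].
  by split; apply/monotoneP=> i j ij; apply: m; rewrite top_le_sum.
by case=> i; case=> j; rewrite top_le_sum //; [exact: m|exact: m'].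
Qed.

(** Points of different summands are incomparable, so equal values across the summands create no
    tie. *)
Lemma ties_sum :
  ties (sum_topology T T') h = (ties T (h \o inl) + ties T' (h \o inr))%N.
Proof.
rewrite /ties big_sumType /=; congr (_ + _)%N; apply: eq_bigr => i _.
  rewrite big_sumType /= [X in (_ + X)%N]big1 ?addn0 => [|j _].
    by apply: eq_bigr => j _; rewrite !top_ltE !top_le_sum.
  by rewrite top_ltE top_le_sum.
rewrite big_sumType /= [X in (X + _)%N]big1 ?add0n => [|j _].
  by apply: eq_bigr => j _; rewrite !top_ltE !top_le_sum.
by rewrite top_ltE top_le_sum.
Qed.

End SumLevels.

Lemma qcoef1 (K : fieldType) m : qcoef (1 : qsym K) m = (m == mone)%:R.
Proof. by []. Qed.

Section Product.
Variables (K : fieldType) (q : K).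

(** Truncations are finite sums, so their product expands by distributivity into a sum over pairs of
    maps, which are the maps on the disjoint union. *)
Lemma trunc_series_sum (E E' : finType) (T : topology E) (T' : topology E') N :
  trunc_series q (sum_topology T T') N = trunc_series q T N * trunc_series q T' N.
Proof.
pose glue (p : {ffun E -> 'I_N} * {ffun E' -> 'I_N}) : {ffun E + E' -> 'I_N} :=
  [ffun x => match x with inl a => p.1 a | inr b => p.2 b end].
have glue_bij : bijective glue.
  exists (fun f : {ffun E + E' -> 'I_N} => ([ffun a => f (inl a)], [ffun b => f (inr b)])).
    by case=> f g; congr (_, _); apply/ffunP=> x; rewrite !ffunE.
  by move=> f; apply/ffunP=> -[x|x]; rewrite !ffunE.
have gl p : (fun x => glue p x : nat) \o inl = (fun x => p.1 x : nat).
  by apply/funext=> x; rewrite /= ffunE.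
have gr p : (fun x => glue p x : nat) \o inr = (fun x => p.2 x : nat).
  by apply/funext=> x; rewrite /= ffunE.
rewrite /trunc_series big_distrlr pair_big /= (reindex glue) /=; last exact: onW_bij.
apply: eq_big => [p|p _]; first by rewrite monotone_sum gl gr.
rewrite ties_sum gl gr exprD -scalerAl -scalerAr scalerA smonomM.
congr (_ *: smonom _ _); rewrite /value_monom big_sumType.
by congr mmul; apply: eq_bigr => x _; rewrite !ffunE.
Qed.

(** The coefficient of a product at [m] involves only divisors of [m], whose variables occur in [m];
    so all three series may be truncated at the same index. *)
Lemma lin_qsym_sum (E E' : finType) (T : topology E) (T' : topology E') :
  lin_qsym q (sum_topology T T') = lin_qsym q T * lin_qsym q T'.
Proof.
apply/val_inj/seriesP=> m /=; have [a ma] := imonom_onto m.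
have mN (p : posn) : (size a < p)%N -> m p = 0%N.
  by move=> ap; rewrite ma imonom_eq0 // => k ka; apply: contraTneq ap => <-; rewrite -leqNgt.
rewrite (lin_series_trunc _ _ mN) trunc_series_sum; apply: series_mul_local => b c bc.
by split; rewrite (@lin_series_trunc _ _ _ _ (size a)) // => p /mN;
  rewrite -bc cmM => /eqP; rewrite addn_eq0 => /andP[/eqP ? /eqP ?].
Qed.

Lemma lin_qsym_card0 (E : finType) (T : topology E) : #|E| = 0%N -> lin_qsym q T = 1.
Proof.
move=> E0; have noE (x : E) : False by have := fintype0 x E0.
apply: qsym_ext => b; rewrite qcoef_lin_qsym.
case: (eqVneq (size b) 0%N) => [b0|b0].
  have -> : (b : seq nat) = [::] by apply/nilP/eqP.
  rewrite /level_coef (big_pred1 [ffun x => match noE x with end]) => [|f].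
    rewrite (_ : ties _ _ = 0%N) ?expr0; last by rewrite /ties big1 // => x; case: (noE x).
    by rewrite qcoef1 /imonom big_ord0 eqxx.
  rewrite /= (_ : (f == _) = true); last by apply/eqP/ffunP=> x; case: (noE x).
  apply/andP; split; first by apply/monotoneP=> x; case: (noE x).
  by apply/forallP=> -[].
rewrite /level_coef big_pred0 => [|f].
  rewrite qcoef1.
  case: eqP => // /(congr1 mdeg); rewrite mdeg_imonom mdeg1 => b1.
  by move: (cpartsP b) b1 b0; case: (b : seq nat) => [|[|n] l].
(* The first part of [b] is positive, whereas every fiber of a map on an empty set is 0. *)
apply/negP=> /andP[_ /forallP h]; have b_gt0 : (0 < size b)%N by rewrite lt0n.
have := h (Ordinal b_gt0); rewrite {1}/fiber big1 => [|x]; last by case: (noE x).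
by rewrite eq_sym eqn0Ngt; rewrite (allP (cpartsP b)) // mem_nth.
Qed.

Lemma qcoef_lin_qsym1 (E : finType) (T : topology E) :
  qcoef (lin_qsym q T) mone = (#|E| == 0%N)%:R.
Proof.
case: (posnP #|E|) => [E0|E_gt0]; first by rewrite lin_qsym_card0 // qcoef1 !eqxx.
rewrite /qcoef [LHS]lin_seriesE; apply: fsbig1 => f _.
case: eqP => [/(congr1 mdeg)|_]; last by rewrite mulr0.
by rewrite mdeg1 mdeg_value_monom => E0; move: E_gt0; rewrite lt0n => /eqP[].
Qed.

End Product.

(** * Cutting a space along an open set *)

Lemma big_sub_setC (E : finType) (O : {set E}) (F : E -> nat) :
  (\sum_x F x = \sum_(a : {x | x \in ~: O}) F (val a) + \sum_(a : {x | x \in O}) F (val a))%N.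
Proof.
rewrite (bigID (fun x => x \in ~: O)) /=; congr (_ + _)%N; first by rewrite big_sub.
rewrite -(big_sub [pred x | x \in O]) /=; by apply: eq_bigl => x; rewrite inE negbK.
Qed.

Lemma notin_setC (E : finType) (O : {set E}) x : ~ x \in O -> x \in ~: O.
Proof. by move/negP; rewrite finset.in_setC. Qed.

Section Cut.
Variables (E : finType) (T : topology E) (O : {set E}).

Lemma ties_cut (f : E -> nat) : (forall x y, x \in O -> y \notin O -> f x != f y) ->
  ties T f = (ties (induced T (~: O)) (f \o val) + ties (induced T O) (f \o val))%N.
Proof.
move=> fO; rewrite /ties (big_sub_setC O).
congr (_ + _)%N; apply: eq_bigr => -[x xO] _; rewrite (big_sub_setC O) /=.
  rewrite [X in (_ + X)%N]big1 ?addn0 => [|[y yO] _].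
    by apply: eq_bigr => y _; rewrite !top_ltE !top_le_pullback.
  have xO' : x \notin O by rewrite -finset.in_setC.
  by rewrite eq_sym (negPf (fO _ _ yO xO')) andbF.
rewrite [X in (X + _)%N]big1 ?add0n => [|[y yO] _].
  by apply: eq_bigr => y _; rewrite !top_ltE !top_le_pullback.
have yO' : y \notin O by rewrite -finset.in_setC.
by rewrite (negPf (fO _ _ xO yO')) andbF.
Qed.

Lemma fiber_cut (f : E -> nat) k :
  fiber f k = (fiber (f \o val : {x | x \in ~: O} -> nat) k +
               fiber (f \o val : {x | x \in O} -> nat) k)%N.
Proof. exact: (big_sub_setC O). Qed.

(** An open set is up-closed, so no relation leads from [O] to its complement; relations in the
    other direction are respected because [f] is larger on [O]. *)
Lemma monotone_cut (f : E -> nat) : O \in opens T ->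
  (forall x y, x \in O -> y \notin O -> (f y <= f x)%N) ->
  monotone T f = monotone (induced T (~: O)) (f \o val) && monotone (induced T O) (f \o val).
Proof.
move=> /open_upP upO fO; apply/monotoneP/andP => [m|[/monotoneP m /monotoneP m'] x y xy].
  by split; apply/monotoneP=> x y; rewrite top_le_pullback; exact: m.
have [yO|yO] := boolP (y \in O); have [xO|xO] := boolP (x \in O).
- by apply: (m' (exist _ x xO) (exist _ y yO)); rewrite top_le_pullback.
- exact: fO.
- by rewrite (upO x y) in yO.
- rewrite -finset.in_setC in xO; rewrite -finset.in_setC in yO.
  by apply: (m (exist _ x xO) (exist _ y yO)); rewrite top_le_pullback.
Qed.

Variables m n : nat.

(* The first m levels are on the complement of O and the last n on O. *)
Definition glue (p : {ffun {x | x \in ~: O} -> 'I_m} * {ffun {x | x \in O} -> 'I_n}) :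
    {ffun E -> 'I_(m + n)} :=
  [ffun x => match pselect (x \in O) with
    | left xO => rshift m (p.2 (exist _ x xO))
    | right xO => lshift n (p.1 (exist _ x (notin_setC xO)))
    end].

Lemma glue_low p a : glue p (val a) = lshift n (p.1 a).
Proof.
case: a => x xO; rewrite ffunE /=; case: pselect => xO'.
  by have := xO; rewrite {1}finset.in_setC xO'.
by congr (lshift _ (_ _)); apply: val_inj.
Qed.

Lemma glue_high p a : glue p (val a) = rshift m (p.2 a).
Proof.
case: a => x xO; rewrite ffunE /=; case: pselect => xO'; last by case: (xO').
by congr (rshift _ (_ _)); apply: val_inj.
Qed.

Lemma glue_ge p x : (m <= glue p x)%N = (x \in O).
Proof.
rewrite ffunE; case: pselect => xO /=; rewrite ?leq_addr ?xO // leqNgt ltn_ord.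
by apply/esym/negP.
Qed.

Lemma glue_inj : injective glue.
Proof.
move=> [g g'] [h h'] /ffunP gh; congr (_, _); apply/ffunP=> a; have := gh (val a).
  by rewrite !glue_low => /lshift_inj.
by rewrite !glue_high => /rshift_inj.
Qed.

Lemma glue_surj (f : {ffun E -> 'I_(m + n)}) : [set x | (m <= f x)%N] = O ->
  exists p, f = glue p.
Proof.
move=> fO; have fm (a : {x | x \in ~: O}) : (f (val a) < m)%N.
  by case: a => x /=; rewrite finset.in_setC -fO inE -ltnNge.
have fn (a : {x | x \in O}) : (f (val a) - m < n)%N.
  case: a => x /=; rewrite -fO inE => mx; by rewrite ltn_subLR.
exists ([ffun a => Ordinal (fm a)], [ffun a => Ordinal (fn a)]); apply/ffunP=> x.
have [xO|] := boolP (x \in O); last rewrite -finset.in_setC => xO.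
  rewrite (glue_high _ (exist _ x xO)) ffunE; apply: val_inj => /=.
  by rewrite subnKC //; move: xO; rewrite -fO inE.
by rewrite (glue_low _ (exist _ x xO)) ffunE; apply: val_inj.
Qed.

End Cut.

Section Deconcatenation.
Variables (K : fieldType) (q : K) (E : finType) (T : topology E).

(** The index type of the sum depends on [size a]; this form allows [size (b ++ c)] to be replaced
    by [size b + size c]. *)
Lemma level_coefE n a : size a = n -> level_coef q T a =
  \sum_(f : {ffun E -> 'I_n} | monotone T (fun i => f i) &&
      [forall k : 'I_n, fiber (fun i => f i) k == nth 0%N a k])
    q ^+ ties T (fun i => f i).
Proof. by move=> <-. Qed.

Section Glue.
Variables (O : {set E}) (OT : O \in opens T) (m n : nat).
Variable p : {ffun {x | x \in ~: O} -> 'I_m} * {ffun {x | x \in O} -> 'I_n}.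
Let f : E -> nat := fun x => glue p x.

Let f_low : f \o val = (fun a => p.1 a : nat).
Proof. by apply/funext=> a; rewrite /f /= glue_low. Qed.

Let f_high : f \o val = (fun a => (m + p.2 a)%N).
Proof. by apply/funext=> a; rewrite /f /= glue_high. Qed.

Let f_lt x y : x \in O -> y \notin O -> (f y < f x)%N.
Proof.
by rewrite -!(glue_ge p) -ltnNge => mx ym; exact: leq_trans mx.
Qed.

Lemma monotone_glue : monotone T f =
  monotone (induced T (~: O)) (fun a => p.1 a) && monotone (induced T O) (fun a => p.2 a).
Proof.
rewrite (monotone_cut OT) => [|x y xO yO]; last exact/ltnW/f_lt.
rewrite f_low f_high; congr (_ && _).
by apply: eq_forallb => i; apply: eq_forallb => j; rewrite leq_add2l.
Qed.

Lemma ties_glue : ties T f =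
  (ties (induced T (~: O)) (fun a => p.1 a) + ties (induced T O) (fun a => p.2 a))%N.
Proof.
rewrite (@ties_cut _ _ O) => [|x y xO yO]; last by rewrite gtn_eqF ?f_lt.
rewrite f_low f_high; congr (_ + _)%N.
by apply: eq_bigr => i _; apply: eq_bigr => j _; rewrite eqn_add2l.
Qed.

Lemma fiber_glue_low k : (k < m)%N -> fiber f k = fiber (fun a => p.1 a) k.
Proof.
move=> km; rewrite (fiber_cut O) f_low f_high [X in (_ + X)%N]big1 ?addn0 // => a _.
by rewrite gtn_eqF // ltn_addr.
Qed.

Lemma fiber_glue_high k : fiber f (m + k) = fiber (fun a => p.2 a) k.
Proof.
rewrite (fiber_cut O) f_low f_high [X in (X + _)%N]big1 ?add0n => [|a _].
  by apply: eq_bigr => a _; rewrite eqn_add2l.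
by rewrite ltn_eqF // ltn_addr.
Qed.

Lemma fibers_glue b c : size b = m ->
  [forall k : 'I_(m + n), fiber f k == nth 0%N (b ++ c) k] =
  [forall k : 'I_m, fiber (fun a => p.1 a) k == nth 0%N b k] &&
  [forall k : 'I_n, fiber (fun a => p.2 a) k == nth 0%N c k].
Proof.
move=> bm; apply/forallP/andP => [h|[/forallP hb /forallP hc] k].
  split; apply/forallP=> k.
    by have := h (lshift n k); rewrite /= fiber_glue_low // nth_cat bm ltn_ord.
  by have := h (rshift m k); rewrite /= fiber_glue_high nth_cat bm ltnNge leq_addr addKn.
case: (split_ordP k) => l -> /=.
  by rewrite fiber_glue_low // nth_cat bm ltn_ord.
by rewrite fiber_glue_high nth_cat bm ltnNge leq_addr addKn.
Qed.

End Glue.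

(** The maps are sorted by the set [O] of points of level at least [size b], which is open by
    monotonicity. For fixed [O], [glue] is a bijection from pairs of maps, and additivity of ties
    turns the power of q into a product. *)
Lemma level_coef_cat (b c : seq nat) : level_coef q T (b ++ c) =
  \sum_(O in opens T) level_coef q (induced T (~: O)) b * level_coef q (induced T O) c.
Proof.
rewrite (level_coefE (size_cat b c)).
pose high (f : {ffun E -> 'I_(size b + size c)}) := [set x | (size b <= f x)%N].
rewrite (partition_big high (fun O => O \in opens T)) /= => [|f /andP[/monotoneP fm _]]; last first.
  apply/open_upP=> x y; rewrite !inE => bx /fm; exact: leq_trans.
apply: eq_bigr => O OT; rewrite /level_coef big_distrlr pair_big /=.
under [RHS]eq_bigr do rewrite -exprD -ties_glue.
rewrite -(@big_imset _ _ _ _ _ (@glue E O (size b) (size c)) _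
  (fun f => q ^+ ties T (fun i => f i))) /=; last by move=> p p' _ _; exact: glue_inj.
apply: eq_bigl => f; apply/idP/imsetP => [/andP[fP /eqP fO]|[p + ->]].
  have [p fE] := glue_surj fO; exists p => //; move: fP.
  by rewrite fE /in_mem /= (monotone_glue OT) fibers_glue // andbACA.
rewrite /in_mem /= (monotone_glue OT) fibers_glue // andbACA => -> /=.
by apply/eqP/setP=> x; rewrite inE glue_ge.
Qed.

End Deconcatenation.

(** * The coproduct *)

(** Linearity is a hypothesis on a bare function, so that the lemma applies to the partial maps of
    the tensor product. *)
Lemma linear_sumZ (K : fieldType) (V W : lmodType K) (f : V -> W) (J : Type) (r : seq J)
    (P : pred J) (c : J -> K) (F : J -> V) : linear f ->
  f (\sum_(j <- r | P j) c j *: F j) = \sum_(j <- r | P j) c j *: f (F j).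
Proof.
move=> lf; have f0 : f 0 = 0.
  by rewrite -[X in f X](addr0 0) -{1}(scaler0 _ (-1)) lf scaleN1r addNr.
elim: r => [|j r IH]; first by rewrite !big_nil.
by rewrite !big_cons; case: (P j); rewrite // lf IH.
Qed.

(** Each factorization of [a] as [b ++ c] arises from exactly one cut point, k = [size b], so
    summing over compositions and cut points is summing over pairs. *)
Lemma sum_deconcat (K : fieldType) (V : lmodType K) d (G : seq nat -> K)
    (H : composition -> composition -> V) :
  (forall a : composition, (d < sumn a)%N -> G a = 0) ->
  let C := fset_set [set a : composition | (sumn a <= d)%N]%classic in
  \sum_(a <- C) G a *: \sum_(k < (size a).+1) H (take_composition k a) (drop_composition k a)
  = \sum_(b <- C) \sum_(c <- C) G (b ++ c) *: H b c.
Proof.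
move=> Gd C; have CP a : (a \in C) = (sumn a <= d)%N.
  by rewrite in_fset_set ?mem_setE //; exact: finite_sumn_le.
pose cut (a b c : composition) := (a : seq nat) == b ++ c.
(* A single term is written as a double sum of Kronecker deltas, so that the sums can be
   exchanged. *)
have pick2 b0 c0 : b0 \in C -> c0 \in C ->
    H b0 c0 = \sum_(b <- C) \sum_(c <- C) if (b == b0) && (c == c0) then H b c else 0.
  move=> bC cC; rewrite (big_fsetD1 b0) //= (big_fsetD1 c0) //= !eqxx /=.
  rewrite big1_fset ?addr0 => [|c]; last by rewrite !inE => /andP[/negPf ->].
  rewrite big1_fset ?addr0 // => b; rewrite !inE => /andP[/negPf -> _] _.
  by rewrite big1.
have cutE (a : composition) : a \in C ->
    \sum_(k < (size a).+1) H (take_composition k a) (drop_composition k a) =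
    \sum_(b <- C) \sum_(c <- C) if cut a b c then H b c else 0.
  rewrite CP => aC; have [tC dC] :
      (forall k, take_composition k a \in C) /\ (forall k, drop_composition k a \in C).
    split=> k; rewrite CP (leq_trans _ aC) // -[X in (_ <= sumn X)%N](cat_take_drop k a);
    by rewrite sumn_cat ?leq_addr ?leq_addl.
  under eq_bigr => k _ do rewrite (pick2 _ _ (tC k) (dC k)).
  rewrite exchange_big /=; apply: eq_bigr => b _.
  rewrite exchange_big /=; apply: eq_bigr => c _.
  rewrite /cut; case: eqP => [abc|abc].
    have bk : (size b < (size a).+1)%N by rewrite abc size_cat ltnS leq_addr.
    rewrite (bigD1 (Ordinal bk)) //= big1 ?addr0 => [|k kb].
      have bE : b = take_composition (size b) a.
        by apply: val_inj; rewrite /= abc take_size_cat.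
      have cE : c = drop_composition (size b) a.
        by apply: val_inj; rewrite /= abc drop_size_cat.
      by rewrite -bE -cE !eqxx.
    case: andP => // -[/eqP bE _]; case/eqP: kb; apply: val_inj; rewrite /= bE /=.
    by rewrite size_takel // -ltnS.
  rewrite big1 // => k _; case: andP => // -[/eqP bE /eqP cE]; case: abc.
  by rewrite bE cE /= cat_take_drop.
rewrite big_seq; under eq_bigr => a aC do rewrite cutE // scaler_sumr.
rewrite -big_seq exchange_big /=; apply: eq_bigr => b _.
under eq_bigr do rewrite scaler_sumr.
rewrite exchange_big /=; apply: eq_bigr => c _.
have bcP : all (fun n => 0 < n)%N (b ++ c) by rewrite all_cat !cpartsP.
pose bc := Composition bcP.
have [bcC|bcC] := boolP (bc \in C).
  rewrite (big_fsetD1 bc) //= /cut eqxx big1_fset ?addr0 // => a.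
  rewrite !inE => /andP[abc _] _; case: eqP => [aE|]; rewrite ?scaler0 //.
  by case/eqP: abc; apply: val_inj.
(* A pair whose concatenation has sum above [d] contributes 0 on both sides. *)
rewrite -[b ++ c]/(bc : seq nat) Gd ?scale0r; last by rewrite ltnNge -CP.
rewrite big1_fset // => a aC _; rewrite /cut; case: eqP => [aE|]; rewrite ?scaler0 //.
by case/negP: bcC; rewrite (_ : bc = a) //; apply: val_inj.
Qed.

Section Coproduct.
Variables (K : fieldType) (q : K) (E : finType) (T : topology E).

(** Both sides are expanded in the tensors of [qsM b] and [qsM c]; their coefficients agree by
    [level_coef_cat]. *)
Lemma qs_coprod_lin_qsym : qs_coprod (lin_qsym q T) =
  \sum_(O in opens T) lin_qsym q (induced T (~: O)) ⊗ lin_qsym q (induced T O).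
Proof.
rewrite (qs_coprodE (@qcoef_lin_qsym0 _ q E T)).
under eq_bigr do rewrite qcoef_lin_qsym.
rewrite (@sum_deconcat _ _ _ (level_coef q T) (fun b c => qsM K b ⊗ qsM K c)); last first.
  by move=> a aE; rewrite -qcoef_lin_qsym qcoef_lin_qsym0 // mdeg_imonom.
set C := fset_set _.
(* A subspace has at most as many points as [E], so one index set [C] serves for all of them. *)
have decomp (Y : {set E}) : lin_qsym q (induced T Y) =
    \sum_(b <- C) level_coef q (induced T Y) b *: qsM K b.
  rewrite {1}[lin_qsym _ _](@qsym_decomp _ _ #|E|) => [|m mE].
    by under eq_bigr do rewrite qcoef_lin_qsym.
  rewrite qcoef_lin_qsym0 //; apply: leq_ltn_trans mE.
  by rewrite card_sig; exact: max_card.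
under [RHS]eq_bigr => O _.
  rewrite (decomp O) (linear_sumZ _ _ _ _ (tens_linear_r _)).
  under eq_bigr do rewrite (decomp (~: O)) (linear_sumZ _ _ _ _ (tens_linear_l _)) scaler_sumr.
  rewrite exchange_big.
  over.
rewrite /= [RHS]exchange_big /=; apply: eq_bigr => b _.
rewrite [RHS]exchange_big /=; apply: eq_bigr => c _.
rewrite level_coef_cat scaler_suml; apply: eq_bigr => O _.
by rewrite scalerA mulrC.
Qed.

End Coproduct.

(** * Antipode and surjectivity *)

Lemma convolution_left_inverse_unique (K : fieldType) (R : comAlgType K)
    (phi S S' : FSpace K -> R) :
  (forall (E : finType) (T : topology E), #|E| = 0%N -> phi (fsb K (finclass T)) = 1) ->
  (forall (E : finType) (T : topology E),
    \sum_(O in opens T) S (fsb K (finclass (induced T (~: O)))) * phi (fsb K (finclass (induced T O))) =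
    \sum_(O in opens T) S' (fsb K (finclass (induced T (~: O)))) * phi (fsb K (finclass (induced T O)))) ->
  forall (E : finType) (T : topology E), S (fsb K (finclass T)) = S' (fsb K (finclass T)).
Proof.
move=> phi1 SS E T; move: {2}#|E|.+1 (ltnSn #|E|) => N.
elim: N E T => // N IH E T; rewrite ltnS => EN.
(* The class of [T] is put in the shape of the left factor of the term for the empty open set. *)
have -> : finclass T = finclass (induced T (~: finset.set0)).
  apply/finclassP/homeo_sym/homeo_pullback.
  have xP (x : E) : x \in ~: (finset.set0 : {set E}) by rewrite finset.in_setC inE.
  by exists (fun x => exist _ x (xP x)) => [a|x] //; apply: val_inj.
have phi0 : phi (fsb K (finclass (induced T finset.set0))) = 1.
  by apply: phi1; rewrite card_sig eq_card0 // => x; rewrite !inE.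
have := SS E T; rewrite [X in X = _](bigD1 finset.set0 (open0 T)).
rewrite [X in _ = X](bigD1 finset.set0 (open0 T)).
have cancel (x y p A B : R) : p = 1 -> A = B -> x * p + A = y * p + B -> x = y.
  by move=> -> ->; rewrite !mulr1; exact: addIr.
apply: (cancel _ _ _ _ _ phi0).
(* The complement of a nonempty open set has fewer points than [E], so the remaining terms agree by
   induction. *)
apply: eq_bigr => O /andP[_ O0]; congr (_ * _); apply: IH; apply: leq_trans EN.
rewrite card_sig -cardsE -(cardsC O) -[X in (X < _)%N]add0n.
rewrite [[set x in _]](_ : _ = ~: O); last by apply/setP=> x; rewrite inE.
by rewrite ltn_add2r card_gt0.
Qed.

(** * Chains of blocks and surjectivity *)

Lemma surjective_of_fibers (E : finType) n (b : composition) (f : E -> 'I_n) : n = size b ->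
  (forall k : 'I_n, fiber (fun x => f x) k = nth 0%N b k) -> forall k, exists x, f x = k.
Proof.
move=> nb fb k; have : (0 < fiber (fun x => f x) k)%N.
  by rewrite fb (allP (cpartsP b)) // mem_nth // -nb.
rewrite lt0n sum_nat_eq0 => /forallPn[x]; rewrite implyTb eqb0 negbK => /eqP fx.
by exists x; apply: val_inj.
Qed.

Section LevelSpace.
Variables (K : fieldType) (q : K) (E : finType) (a : composition) (l : E -> 'I_(size a)).
Hypothesis la : forall k, fiber (fun x => l x) k = nth 0%N a k.

Let T := level_topology (fun x => l x).

Lemma ties_level : ties T (fun x => l x) = 0%N.
Proof.
rewrite /ties big1 // => i _; rewrite big1 // => j _.
by rewrite top_ltE !top_le_level; case: ltngtP.
Qed.

(** A monotone map is constant on each block, hence of the form h composed with [l]. Being onto at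
    least as many levels as there are blocks, h is an increasing bijection, so the map is [l]
    itself, which has no ties. *)
Lemma level_coef_level (b : composition) :
  (size a <= size b)%N -> level_coef q T b = (b == a)%:R.
Proof.
move=> ab.
have key n (f : {ffun E -> 'I_n}) : n = size b -> monotone T (fun x => f x) ->
    (forall k : 'I_n, fiber (fun x => f x) k = nth 0%N b k) ->
    b = a /\ forall x, f x = l x :> nat.
  move=> nb /monotoneP fm fb.
  have fs := surjective_of_fibers nb fb.
  have ls := surjective_of_fibers (erefl (size a)) (fun k => la k).
  pose s k := projT1 (cid (ls k)); have ks k : l (s k) = k by rewrite /s; case: cid.
  pose h k := f (s k).
  have fh x : f x = h (l x).
    by apply/val_inj/eqP; rewrite eqn_leq /h !fm // top_le_level ks.
  have hs k : exists j, h j = k by have [x <-] := fs k; exists (l x); rewrite -fh.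
  pose r k := projT1 (cid (hs k)); have rk k : h (r k) = k by rewrite /r; case: cid.
  have rI : injective r by exact: can_inj rk.
  have nE : n = size a.
    (* The section [r] of [h] embeds the levels into the blocks; the hypothesis on sizes gives the
       other inequality. *)
    by apply/eqP; rewrite eqn_leq {2}nb ab andbT -(card_ord n) -[size a]card_ord (leq_card r rI).
  have hI : injective h.
    have [r' r'r rr'] : bijective r by apply: inj_card_bij; rewrite // !card_ord nE.
    by move=> j j'; rewrite -(rr' j) -(rr' j') !rk => ->.
  have hm (j j' : 'I_(size a)) : (j <= j')%N -> (h j <= h j')%N.
    by move=> jj; rewrite /h fm // top_le_level !ks.
  (* The values of [h] form a sorted list that is a permutation of all the levels, which forces [h]
     to be the identity on indices. *)
  have hE : [seq (h j : nat) | j <- enum 'I_(size a)] = iota 0 (size a).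
    apply: (@sorted_eq _ leq leq_trans anti_leq); first last.
    - apply: uniq_perm; rewrite ?iota_uniq //.
        by rewrite map_inj_uniq ?enum_uniq // => j j' /val_inj/hI.
      move=> k; rewrite mem_iota add0n /=; apply/mapP/idP => [[j _ ->]|ka].
        by rewrite -[X in (_ < X)%N]nE.
      have kn : (k < n)%N by rewrite nE.
      by exists (r (Ordinal kn)); rewrite ?mem_enum // rk.
    - exact: iota_sorted.
    - apply: (homo_sorted (e := fun j j' : 'I_(size a) => (j <= j')%N)) => //.
      by have := iota_sorted 0 (size a); rewrite -val_enum_ord sorted_map.
  have hj (j : 'I_(size a)) : h j = j :> nat.
    have := congr1 (fun t => nth 0%N t j) hE; rewrite nth_iota // add0n.
    by rewrite (nth_map j) ?size_enum_ord // nth_ord_enum.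
  have fl x : f x = l x :> nat by rewrite fh hj.
  split=> //; apply/val_inj/(@eq_from_nth _ 0%N) => [|k]; rewrite /= -nb ?nE //.
  move=> kn; rewrite -la -(fb (Ordinal (etrans (congr1 _ nE) kn))) /=.
  by apply: eq_bigr => x _; rewrite fl.
rewrite /level_coef; case: (eqVneq b a) => [ba|/eqP ba]; last first.
  rewrite big_pred0 // => f; apply/negP=> /andP[fm /forallP fb]; case: ba.
  by have [] := key _ f erefl fm (fun k => eqP (fb k)).
rewrite ba in key *; rewrite (big_pred1 [ffun x => l x]) => [|f].
  have lE : (fun x => [ffun x => l x] x : nat) = (fun x => l x : nat).
    by apply/funext=> x; rewrite ffunE.
  by rewrite lE ties_level expr0.
apply/idP/eqP => [/andP[fm /forallP fb]|->].
  have [_ fl] := key _ f erefl fm (fun k => eqP (fb k)).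
  by apply/ffunP=> x; rewrite ffunE; apply/val_inj/fl.
have lE : (fun x => [ffun x => l x] x : nat) = (fun x => l x : nat).
  by apply/funext=> x; rewrite ffunE.
rewrite lE; apply/andP; split; last by apply/forallP=> k; rewrite la.
by apply/monotoneP=> x y; rewrite top_le_level.
Qed.

End LevelSpace.

(** Membership in a subspace is expressed by a predicate closed under linear combinations. The
    induction is on the number of parts, by unitriangularity of the chains of blocks. *)
Lemma qsM_lin_qsym_span (K : fieldType) (q : K) (P : qsym K -> Prop) :
  P 0 -> (forall c g h, P g -> P h -> P (c *: g + h)) ->
  (forall (E : finType) (T : topology E), P (lin_qsym q T)) ->
  forall a, P (qsM K a).
Proof.
move=> P0 PD PT a; move: {2}(size a).+1 (ltnSn (size a)) => N.
elim: N a => // N IH a; rewrite ltnS => aN.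
(* The points are pairs of a block and a position in it, so the block index [l] has fibers of sizes
   given by [a]. *)
pose E : finType := {k : 'I_(size a) & 'I_(nth 0%N a k)}.
pose l (x : E) := tag x.
have la k : fiber (fun x => l x) k = nth 0%N a k.
  rewrite /fiber -(@sig_big_dep _ _ _ _ (fun i : 'I_(size a) => 'I_(nth 0%N a i)) xpredT
    (fun _ => xpredT) (fun i _ => (i == k :> nat) : nat)) /=.
  under eq_bigr => i _ do rewrite sum_nat_const card_ord.
  case: (ltnP k (size a)) => ka; last first.
    rewrite nth_default // big1 // => i _.
    by rewrite ltn_eqF ?muln0 // (leq_trans _ ka).
  rewrite (bigD1 (Ordinal ka)) //= eqxx muln1 big1 ?addn0 // => i ik.
  by rewrite (_ : (i == k :> nat) = false) ?muln0 //; apply: contraNF ik => /eqP ik; exact/eqP/val_inj.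
pose T := level_topology (fun x => l x).
have coefT (b : composition) : (size a <= size b)%N -> qcoef (lin_qsym q T) (imonom posnS b) = (b == a)%:R.
  by move=> ab; rewrite qcoef_lin_qsym; exact: (level_coef_level q la).
pose C := fset_set [set b : composition | (sumn b <= #|E|)%N]%classic.
(* Otherwise the coefficient at [a], which is 1, would vanish for degree reasons. *)
have aC : a \in C.
  rewrite in_fset_set ?mem_set //=; last exact: finite_sumn_le.
  rewrite leqNgt; apply/negP => aE.
  have /eqP := coefT a (leqnn _); rewrite qcoef_lin_qsym0 ?mdeg_imonom // eqxx.
  by rewrite eq_sym oner_eq0.
have := qsym_decomp (@qcoef_lin_qsym0 K q E T).
rewrite (big_fsetD1 a) // coefT // eqxx scale1r => /eqP.
(* The expansion is solved for [qsM K a]; in the remaining sum the compositions at least as long as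
   [a] have coefficient 0 and the shorter ones fall under the induction hypothesis. *)
rewrite -subr_eq => /eqP <-; rewrite addrC -scaleN1r; apply: (PD); last exact: PT.
rewrite big_seq; apply: (big_ind P) => // [g h Pg Ph|b].
  by rewrite -[g]scale1r; exact: PD.
rewrite !inE => /andP[ba _]; have [ab|ba'] := leqP (size a) (size b).
  by rewrite coefT // (negPf ba) scale0r.
by rewrite -[_ *: _]addr0; apply: (PD) => //; apply: IH; exact: leq_trans aN.
Qed.

Lemma qsym_span (K : fieldType) (q : K) (P : qsym K -> Prop) :
  P 0 -> (forall c g h, P g -> P h -> P (c *: g + h)) ->
  (forall (E : finType) (T : topology E), P (lin_qsym q T)) ->
  forall g, P g.
Proof.
move=> P0 PD PT g; have [d gd] := qs_bounded g; rewrite (qsym_decomp gd).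
elim: (enum_fset _) => [|a r IH]; first by rewrite big_nil.
by rewrite big_cons; apply: (PD) => //; exact: (qsM_lin_qsym_span P0 PD PT).
Qed.

(** * The morphism *)

Section Phi.
Variables (K : fieldType) (q : K).

Definition space_qsym (s : finspace) : qsym K := lin_qsym q (tagged (repr s)).

Definition phi_q (x : FSpace K) : qsym K := \sum_(s <- msupp x) x@_s *: space_qsym s.

Lemma phi_qEw (d : {fset finspace}) (x : FSpace K) : (msupp x `<=` d)%fset ->
  phi_q x = \sum_(s <- d) x@_s *: space_qsym s.
Proof.
move=> le; rewrite /phi_q (big_fset_incl _ le) // => s _ /mcoeff_outdom ->.
by rewrite scale0r.
Qed.

Fact phi_q_linear : linear phi_q.
Proof.
move=> a x y; pose d := (msupp (a *: x + y) `|` (msupp x `|` msupp y))%fset.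
rewrite (@phi_qEw d x) ?(@phi_qEw d y) ?(@phi_qEw d (_ + _)) /d ?fsubsetUl //;
  try by apply/fsubsetP=> p; rewrite !inE => ->; rewrite ?orbT.
rewrite scaler_sumr -big_split /=; apply: eq_bigr => s _.
by rewrite mcoeffD mcoeffZ scalerDl scalerA.
Qed.
HB.instance Definition _ := GRing.isLinear.Build K (FSpace K) (qsym K) _ phi_q phi_q_linear.

Lemma phi_qP c x y : phi_q (c *: x + y) = c *: phi_q x + phi_q y.
Proof. exact: phi_q_linear. Qed.

Lemma phi_qE (E : finType) (T : topology E) : phi_q (fsb K (finclass T)) = lin_qsym q T.
Proof.
rewrite (@phi_qEw [fset finclass T]%fset) ?msuppU_le // big_seq_fset1 mcoeffUU scale1r.
by apply/lin_qsym_homeo/finclassP; rewrite finclass_repr.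
Qed.

Lemma FSpace_ind (P : FSpace K -> Prop) :
  P 0 -> (forall c x y, P x -> P y -> P (c *: x + y)) ->
  (forall (E : finType) (T : topology E), P (fsb K (finclass T))) -> forall x, P x.
Proof.
move=> P0 PD PT x; rewrite (monalgE x); elim: (enum_fset _) => [|s r IH].
  by rewrite big_nil.
rewrite big_cons (_ : << x@_s *g s >> = x@_s *: fsb K s); last first.
  by rewrite /fsb -mul_malgC malgM_def fgmulUU mul1m mulr1.
by apply: (PD) => //; elim/finspaceW: s => E T; exact: PT.
Qed.

Lemma FSpace_linear_eq (V : lmodType K) (f g : FSpace K -> V) : linear f -> linear g ->
  (forall (E : finType) (T : topology E), f (fsb K (finclass T)) = g (fsb K (finclass T))) ->
  f =1 g.
Proof.
move=> lf lg fg; apply: FSpace_ind => // [|c x y fx fy]; last by rewrite lf lg fx fy.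
have lin0 (h : FSpace K -> V) : linear h -> h 0 = 0.
  by move=> lh; have := lh (-1) 0 0; rewrite scaler0 addr0 scaleN1r addNr.
by rewrite !lin0.
Qed.

Lemma fs_counitE (E : finType) (T : topology E) :
  fs_counit (fsb K (finclass T)) = (#|E| == 0%N)%:R.
Proof.
rewrite /fs_counit /fsb mcoeffU1; congr ((nat_of_bool _)%:R).
by apply/eqP/eqP => /finclass_eq1.
Qed.

Lemma fsb_mul (s t : finspace) : fsb K s * fsb K t = fsb K (fs_mul s t).
Proof. by rewrite /fsb malgM_def fgmulUU mulr1. Qed.

Lemma phi_q1 : phi_q 1 = 1.
Proof.
rewrite -[1 in LHS]/(fsb K (finclass void_topology)) phi_qE lin_qsym_card0 //.
exact: card_void.
Qed.

(** Linearity in each argument reduces the claim to two finite spaces, where it is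
    [lin_qsym_sum]. *)
Lemma phi_qM : {morph phi_q : x y / x * y}.
Proof.
move=> x y; elim/FSpace_ind: x => [|c x x' IH IH'|E T].
- by rewrite mul0r linear0 mul0r.
- have -> : (c *: x + x') * y = c *: (x * y) + x' * y :> FSpace K.
    by rewrite mulrDl scalerAl.
  by rewrite !phi_qP (mulrDl (c *: phi_q x)) -(scalerAl c (phi_q x)); congr (_ *: _ + _).
elim/FSpace_ind: y => [|c y y' IH IH'|E' T'].
- by rewrite mulr0 linear0 mulr0.
- have -> : fsb K (finclass T) * (c *: y + y') =
      c *: (fsb K (finclass T) * y) + fsb K (finclass T) * y' :> FSpace K.
    by rewrite mulrDr scalerAr.
  by rewrite !phi_qP mulrDr -scalerAr; congr (_ *: _ + _).
transitivity (phi_q (fsb K (finclass (sum_topology T T')))).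
  by congr phi_q; rewrite fsb_mul fs_mulE.
transitivity (lin_qsym q T * lin_qsym q T'); first by rewrite -lin_qsym_sum; exact: phi_qE.
by congr (_ * _); rewrite phi_qE.
Qed.

Lemma phi_q_coprod x : tensor_map phi_q phi_q (fs_coprod x) = qs_coprod (phi_q x).
Proof.
move: x; apply: FSpace_linear_eq => [||E T].
- exact: (linearP (tensor_map phi_q phi_q \o @fs_coprod K)).
- exact: (linearP (@qs_coprod K \o phi_q)).
rewrite fs_coprodE phi_qE qs_coprod_lin_qsym linear_sum /=.
by apply: eq_bigr => O _; rewrite tensor_mapE; congr (_ ⊗ _); exact: phi_qE.
Qed.

Lemma phi_q_counit x : qs_counit (phi_q x) = fs_counit x.
Proof.
(* The counits are compared as linear maps into the field seen as a module over itself. *)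
move: x; apply: (@FSpace_linear_eq K^o) => [c x y|c x y|E T].
- by rewrite phi_qP.
- by rewrite /fs_counit mcoeffD mcoeffZ.
by rewrite phi_qE fs_counitE -(qcoef_lin_qsym1 q T).
Qed.

Lemma antipode_sum (A : algType K) (S : {linear A -> A}) (I : finType) (P : pred I)
    (u v : I -> A) :
  tensor_mul (tensor_map S idfun (\sum_(i | P i) u i ⊗ v i)) = \sum_(i | P i) S (u i) * v i.
Proof.
rewrite -[LHS]/((@tensor_mul K A \o tensor_map S idfun) _) linear_sum.
by apply: eq_bigr => i _; rewrite /= tensor_mapE tensor_mulE.
Qed.

Lemma phi_q_antipode (SA : {linear FSpace K -> FSpace K}) (SB : {linear qsym K -> qsym K}) :
  is_antipode (@fs_coprod K) (@fs_counit K) SA ->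
  is_antipode (@qs_coprod K) (@qs_counit K) SB -> forall x, phi_q (SA x) = SB (phi_q x).
Proof.
move=> [hA _] [hB _]; apply: FSpace_linear_eq => [||E T].
- exact: (linearP (phi_q \o SA)).
- exact: (linearP (SB \o phi_q)).
apply: (@convolution_left_inverse_unique _ _ phi_q (phi_q \o SA) (SB \o phi_q)) => {}E {}T.
  by move=> E0; rewrite phi_qE lin_qsym_card0.
have scalar_phi c : phi_q c%:A = c%:A by rewrite linearZ /= phi_q1.
(* The image under [phi_q] of the antipode identity in [FSpace] is the convolution of [phi_q \o SA]
   with [phi_q]. *)
have /(congr1 phi_q) := hA (fsb K (finclass T)).
rewrite fs_coprodE antipode_sum scalar_phi (linear_sum phi_q) /= => eA.
(* The antipode identity in [qsym], taken at the image of [T], is a sum over the same open sets;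
   compatibility with the counits equates the two right-hand sides. *)
have := hB (lin_qsym q T).
rewrite qs_coprod_lin_qsym antipode_sum -{1}phi_qE phi_q_counit -eA => eB.
under eq_bigr => O _ do rewrite /= -phi_qM.
rewrite -eB; apply: eq_bigr => O _; congr (SB _ * _); exact/esym/phi_qE.
Qed.

Lemma phi_q_surj g : exists x, phi_q x = g.
Proof.
elim/(qsym_span (q := q)): g => [|c g h [x <-] [y <-]|E T].
- by exists 0; rewrite linear0.
- by exists (c *: x + y); rewrite linearP.
- by exists (fsb K (finclass T)); rewrite phi_qE.
Qed.

End Phi.

Theorem theorem21 (K : fieldType) (q : K) :
  exists phi : {linear FSpace K -> qsym K},
    [/\ forall (E : finType) (T : topology E),
          qsval (phi (fsb K (finclass T))) =
          series_sum (Lin T)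
            (fun f => q ^+ alpha T f *: \prod_(i : E) svar K (f i)),
        hopf_morphism (@fs_coprod K) (@fs_counit K)
                      (@qs_coprod K) (@qs_counit K) phi,
        forall g : qsym K, exists x : FSpace K, phi x = g
      & forall (E : finType) (T : topology E),
          phi (fsb K (finclass T)) =
          \sum_(f \in LinStd T) q ^+ alpha T f *: qsM K (packing f)].
Proof.
exists (phi_q q); split=> [E T||g|E T].
- exact: (congr1 (@qsval K) (phi_qE q T)).
- split; [exact: phi_q1|exact: phi_qM|exact: phi_q_coprod|exact: phi_q_counit|].
  exact: phi_q_antipode.
- exact: phi_q_surj.
- exact: etrans (phi_qE q T) (lin_qsym_std q T).
Qed.
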